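(* Let $(A,A^\pm,\delta)$ be data satisfying conditions (T0), (T1), (T2) listed in the context, and let ${}^{\uparrow}\mathscr{O}$ be the full subcategory of the category of left $A$-modules whose objects are the finitely generated $A$-modules $M$ such that the $\bar A^-$-action on $M$ is locally nilpotent. Then: (i) The $\delta$-action on any object $M\in{}^{\uparrow}\mathscr{O}$ is locally finite, and all generalized eigenspaces of this $\delta$-action are finite dimensional. (ii) The category ${}^{\uparrow}\mathscr{O}$ is abelian and any object of ${}^{\uparrow}\mathscr{O}$ has finite length. (iii) The category ${}^{\uparrow}\mathscr{O}$ has only finitely many isomorphism classes of simple objects. (iv) The category ${}^{\uparrow}\mathscr{O}$ has enough projective and enough injective objects.
   Context: Algebras are associative over $\mathbb{C}$, $\otimes=\otimes_{\mathbb{C}}$. Let $A=\bigoplus_{m\in\mathbb{Z}}A(m)$ be a $\mathbb{Z}$-graded unital algebra, $A^\pm=\bigoplus_{m\in\mathbb{Z}}A^\pm(m)\subset A$ a pair of graded unital subalgebras, and $\delta\in A$ an element. Conditions: (T0) $A$ is finitely generated as an $(A^+\text{-}A^-)$-bimodule, i.e. as an $A^+\otimes(A^-)^{\mathrm{op}}$-module. (T1) The grading on $A$ is inner: $[\delta,a]=m\cdot a$ for all $m\in\mathbb{Z}$, $a\in A(m)$. (T2) Each of the two algebras $A^\pm$ is finitely generated; $A^+(m)=0$ for all $m<0$ and $A^-(m)=0$ for all $m>0$; and $A^+(0)=\mathbb{C}=A^-(0)$. Put $\bar A^\pm:=\bigoplus_{m>0}A^\pm(\pm m)$ (augmentation ideals).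 The $\delta$-action on $M$ is locally finite if every element of $M$ lies in a $\delta$-stable finite-dimensional subspace. The action of a nonunital algebra $\mathcal{A}$ on $M$ is locally nilpotent if for every $m\in M$ there is $n=n(m)>0$ with $a_1\cdots a_n m=0$ for all $a_1,\dots,a_n\in\mathcal{A}$. *)

(* Defs.v *)
From HB Require Import structures.
From mathcomp Require Import all_boot all_order all_algebra finmap.
From mathcomp Require Import boolp classical_sets reals complex.

Set Implicit Arguments.
Unset Strict Implicit.
Unset Printing Implicit Defensive.

Import Order.TTheory GRing.Theory Num.Theory.
Local Open Scope classical_set_scope.
Local Open Scope ring_scope.

Record preadditive_category := PreadditiveCategory {
  Ob : Type;
  Mor : Ob -> Ob -> zmodType;
  idm : forall X, Mor X X;
  mcomp : forall X Y Z, Mor Y Z -> Mor X Y -> Mor X Z;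
  mcomp1m : forall X Y (f : Mor X Y), mcomp (idm Y) f = f;
  mcompm1 : forall X Y (f : Mor X Y), mcomp f (idm X) = f;
  mcompA : forall X Y Z T (h : Mor Z T) (g : Mor Y Z) (f : Mor X Y),
    mcomp h (mcomp g f) = mcomp (mcomp h g) f;
  mcompDl : forall X Y Z (g h : Mor Y Z) (f : Mor X Y),
    mcomp (g + h) f = mcomp g f + mcomp h f;
  mcompDr : forall X Y Z (g : Mor Y Z) (f h : Mor X Y),
    mcomp g (f + h) = mcomp g f + mcomp g h
}.

Arguments Mor {C} X Y : rename.
Arguments idm {C} X : rename.
Arguments mcomp {C X Y Z} g f : rename.

Section CategoryNotions.
Variable C : preadditive_category.
Implicit Types X Y Z : Ob C.

Definition is_iso X Y (f : Mor X Y) : Prop :=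
  exists g : Mor Y X, mcomp g f = idm X /\ mcomp f g = idm Y.

Definition isomorphic X Y : Prop := exists f : Mor X Y, is_iso f.

Definition is_mono X Y (f : Mor X Y) : Prop :=
  forall Z (g h : Mor Z X), mcomp f g = mcomp f h -> g = h.

Definition is_epi X Y (f : Mor X Y) : Prop :=
  forall Z (g h : Mor Y Z), mcomp g f = mcomp h f -> g = h.

Definition is_zero_object Z : Prop :=
  forall X, (exists! f : Mor Z X, True) /\ (exists! f : Mor X Z, True).

Definition is_biproduct X Y P (iX : Mor X P) (iY : Mor Y P)
    (pX : Mor P X) (pY : Mor P Y) : Prop :=
  [/\ mcomp pX iX = idm X, mcomp pY iY = idm Y, mcomp pY iX = 0, mcomp pX iY = 0
    & mcomp iX pX + mcomp iY pY = idm P].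

Definition is_kernel X Y (f : Mor X Y) K (k : Mor K X) : Prop :=
  mcomp f k = 0 /\
  forall Z (g : Mor Z X), mcomp f g = 0 -> exists! h : Mor Z K, mcomp k h = g.

Definition is_cokernel X Y (f : Mor X Y) Q (q : Mor Y Q) : Prop :=
  mcomp q f = 0 /\
  forall Z (g : Mor Y Z), mcomp g f = 0 -> exists! h : Mor Q Z, mcomp h q = g.

Definition is_abelian : Prop :=
  (exists Z, is_zero_object Z) /\
  (forall X Y, exists P (iX : Mor X P) (iY : Mor Y P) (pX : Mor P X)
     (pY : Mor P Y), is_biproduct iX iY pX pY) /\
  (forall X Y (f : Mor X Y), exists K (k : Mor K X), is_kernel f k) /\
  (forall X Y (f : Mor X Y), exists Q (q : Mor Y Q), is_cokernel f q) /\
  (forall X Y (f : Mor X Y), is_mono f ->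
     exists Z (g : Mor Y Z), is_kernel g f) /\
  (forall X Y (f : Mor X Y), is_epi f ->
     exists Z (g : Mor Z X), is_cokernel g f).

Definition is_simple X : Prop :=
  ~ is_zero_object X /\
  forall Y (f : Mor Y X), is_mono f -> is_zero_object Y \/ is_iso f.

(* A composition series 0 = F 0 -> F 1 -> ... -> F n = X; the values of F
   and i beyond n are irrelevant. *)
Definition has_finite_length X : Prop :=
  exists (n : nat) (F : nat -> Ob C) (i : forall k, Mor (F k) (F k.+1)),
    [/\ is_zero_object (F 0%N), isomorphic (F n) X
      & forall k, (k < n)%N -> is_mono (i k) /\
          exists S (p : Mor (F k.+1) S), is_simple S /\ is_cokernel (i k) p].

Definition finitely_many_simples : Prop :=
  exists (n : nat) (S : 'I_n -> Ob C), (forall j, is_simple (S j)) /\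
    forall X, is_simple X -> exists j, isomorphic X (S j).

Definition is_projective P : Prop :=
  forall X Y (f : Mor X Y) (g : Mor P Y), is_epi f ->
    exists h : Mor P X, mcomp f h = g.

Definition is_injective I : Prop :=
  forall X Y (f : Mor X Y) (g : Mor X I), is_mono f ->
    exists h : Mor Y I, mcomp h f = g.

Definition enough_projectives : Prop :=
  forall X, exists P (f : Mor P X), is_projective P /\ is_epi f.

Definition enough_injectives : Prop :=
  forall X, exists I (f : Mor X I), is_injective I /\ is_mono f.

End CategoryNotions.

Definition full_subcategory (C : preadditive_category) (P : Ob C -> Prop) :
    preadditive_category :=
  @PreadditiveCategory {X : Ob C | P X} (fun X Y => Mor (sval X) (sval Y))
    (fun X => idm (sval X)) (fun X Y Z g f => mcomp g f)
    (fun X Y => @mcomp1m C (sval X) (sval Y))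
    (fun X Y => @mcompm1 C (sval X) (sval Y))
    (fun X Y Z T => @mcompA C (sval X) (sval Y) (sval Z) (sval T))
    (fun X Y Z => @mcompDl C (sval X) (sval Y) (sval Z))
    (fun X Y Z => @mcompDr C (sval X) (sval Y) (sval Z)).

Section LinearZmodule.
Variables (A : pzRingType) (M N : lmodType A).

Lemma linear_ext (f g : {linear M -> N}) : f =1 g -> f = g.
Proof.
case: f => f cf; case: g => g cg /= /funext fg; subst g.
case: cf => [[f1] [f2]]; case: cg => [[g1] [g2]].
by congr GRing.Linear.Pack; congr GRing.Linear.Class; congr (_ _);
  exact: Prop_irrelevance.
Qed.

HB.instance Definition _ := gen_eqMixin {linear M -> N}.
HB.instance Definition _ := gen_choiceMixin {linear M -> N}.

Definition lin_zero : {linear M -> N} := \0.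
Definition lin_opp (f : {linear M -> N}) : {linear M -> N} := \- f.
Definition lin_add (f g : {linear M -> N}) : {linear M -> N} := f \+ g.

Fact lin_addA : associative lin_add.
Proof. by move=> f g h; apply: linear_ext => x /=; rewrite addrA. Qed.
Fact lin_addC : commutative lin_add.
Proof. by move=> f g; apply: linear_ext => x /=; rewrite addrC. Qed.
Fact lin_add0 : left_id lin_zero lin_add.
Proof. by move=> f; apply: linear_ext => x /=; rewrite add0r. Qed.
Fact lin_addN : left_inverse lin_zero lin_opp lin_add.
Proof. by move=> f; apply: linear_ext => x /=; rewrite addNr. Qed.

HB.instance Definition _ := GRing.isZmodule.Build {linear M -> N}
  lin_addA lin_addC lin_add0 lin_addN.

End LinearZmodule.

Section ModuleCategory.
Variable A : pzRingType.

Definition lin_id (M : lmodType A) : {linear M -> M} := idfun.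
Definition lin_comp (M N P : lmodType A) (g : {linear N -> P})
  (f : {linear M -> N}) : {linear M -> P} := g \o f.

Fact lin_comp1m (M N : lmodType A) (f : {linear M -> N}) :
  lin_comp (lin_id N) f = f.
Proof. exact: linear_ext. Qed.
Fact lin_compm1 (M N : lmodType A) (f : {linear M -> N}) :
  lin_comp f (lin_id M) = f.
Proof. exact: linear_ext. Qed.
Fact lin_compA (M N P Q : lmodType A) (h : {linear P -> Q})
  (g : {linear N -> P}) (f : {linear M -> N}) :
  lin_comp h (lin_comp g f) = lin_comp (lin_comp h g) f.
Proof. exact: linear_ext. Qed.
Fact lin_compDl (M N P : lmodType A) (g h : {linear N -> P})
  (f : {linear M -> N}) : lin_comp (g + h) f = lin_comp g f + lin_comp h f.
Proof. exact: linear_ext. Qed.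
Fact lin_compDr (M N P : lmodType A) (g : {linear N -> P})
  (f h : {linear M -> N}) : lin_comp g (f + h) = lin_comp g f + lin_comp g h.
Proof. by apply: linear_ext => x /=; rewrite raddfD. Qed.

Definition module_category : preadditive_category :=
  @PreadditiveCategory (lmodType A) (fun M N => {linear M -> N}) lin_id
    lin_comp lin_comp1m lin_compm1 lin_compA lin_compDl lin_compDr.

Definition finitely_generated_module (M : lmodType A) : Prop :=
  exists (n : nat) (e : 'I_n -> M), forall x : M,
    exists a : 'I_n -> A, x = \sum_(j < n) a j *: e j.

(* B need not contain 1. *)
Definition locally_nilpotent (B : set A) (M : lmodType A) : Prop :=
  forall x : M, exists n : nat, (0 < n)%N /\
    forall a : 'I_n -> A, (forall j, B (a j)) -> (\prod_(j < n) a j) *: x = 0.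

End ModuleCategory.

Section VectorSpace.
Variables (K : fieldType) (A : algType K) (M : lmodType A).

(* M is a K-vector space through c |-> c%:A; a finite-dimensional subspace is
   the span of a finite family. *)
Definition Kspan (n : nat) (e : 'I_n -> M) : set M :=
  [set x | exists c : 'I_n -> K, x = \sum_(j < n) (c j)%:A *: e j].

Definition finite_dimensional (S : set M) : Prop :=
  exists (n : nat) (e : 'I_n -> M), S = Kspan e.

Definition locally_finite (d : A) : Prop :=
  forall x : M, exists S : set M,
    [/\ finite_dimensional S, S x & forall y, S y -> S (d *: y)].

Definition generalized_eigenspace (d : A) (l : K) : set M :=
  [set x | exists n : nat, (d - l%:A) ^+ n *: x = 0].

End VectorSpace.

Arguments locally_finite {K A} M d.
Arguments generalized_eigenspace {K A} M d l.

Section GradedAlgebra.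
Variables (K : fieldType) (A : algType K).
Implicit Types (G F : int -> set A) (B : set A).

Definition graded_sum F (P : pred int) : set A :=
  [set a | exists (s : {fset int}) (f : int -> A),
    (forall m, m \in s -> P m /\ F m (f m)) /\ a = \sum_(m <- s) f m].

Definition independent F : Prop :=
  forall (s : {fset int}) (f : int -> A),
    (forall m, m \in s -> F m (f m)) -> \sum_(m <- s) f m = 0 ->
    forall m, m \in s -> f m = 0.

Definition algebra_grading G : Prop :=
  [/\ forall m, submod_closed [in G m],
      graded_sum G predT = setT,
      independent G,
      G 0 1
    & forall m n a b, G m a -> G n b -> G (m + n) (a * b)].

Definition component G B (m : int) : set A := B `&` G m.

Definition graded_subalgebra G B : Prop :=
  subalg_closed [in B] /\ B = graded_sum (component G B) predT.

Definition finitely_generated_algebra B : Prop :=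
  exists s : seq A,
    B = smallest (fun S : set A => subalg_closed [in S]) [set` s].

(* An element \sum_p p.1 (x) p.2 of Ap (x) Am^op acts on A by
   g |-> \sum_p p.1 * g * p.2. *)
Definition finitely_generated_bimodule (Ap Am : set A) : Prop :=
  exists (n : nat) (g : 'I_n -> A), forall a : A,
    exists t : 'I_n -> seq (A * A),
      (forall j p, p \in t j -> Ap p.1 /\ Am p.2) /\
      a = \sum_(j < n) \sum_(p <- t j) p.1 * g j * p.2.

Definition inner_grading G (d : A) : Prop :=
  forall (m : int) (a : A), G m a -> d * a - a * d = a *~ m.

Definition positivity_conditions G (Ap Am : set A) : Prop :=
  [/\ finitely_generated_algebra Ap /\ finitely_generated_algebra Am,
      forall m : int, m < 0 -> component G Ap m = [set 0],
      forall m : int, 0 < m -> component G Am m = [set 0],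
      component G Ap 0 = range (fun c : K => c%:A)
    & component G Am 0 = range (fun c : K => c%:A)].

Definition augmentation_minus G (Am : set A) : set A :=
  graded_sum (fun m => component G Am (- m)) (fun m => 0 < m).

Definition in_category_O G (Am : set A) (M : lmodType A) : Prop :=
  finitely_generated_module M /\
  locally_nilpotent (augmentation_minus G Am) M.

Definition category_O G (Am : set A) : preadditive_category :=
  @full_subcategory (module_category A) (in_category_O G Am).

End GradedAlgebra.

(* Main.v *)
(* For a module on which the negative part acts locally nilpotently, every
   vector is killed by all components [A(m)] with [m] very negative, and the
   triangular decomposition makes each [A(m)] finite dimensional modulo the left
   ideal generated by those components.  Hence [delta] satisfies a polynomial
   identity on the vectors killed by [A(m)], m <= -N, which depends only on [N].
   For N = 1 its roots are the possible lowest weights; taking a large power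
   [q] of that polynomial, the functor M |-> ker q(delta) is, uniformly in M,
   exact, faithful and finite dimensional on finitely generated M.  Its
   faithful exactness bounds lengths; the functor M |-> ker q(delta) is
   represented by a quotient of [A], which is thus a projective generator whose
   composition factors are all the simple objects; and its dual is represented
   by a submodule of [Hom_K(A, K)], which gives the injectives. *)
Require Import Defs.
From HB Require Import structures.
From mathcomp Require Import all_boot all_order all_algebra finmap.
From mathcomp Require Import boolp classical_sets reals complex.
From mathcomp Require Import zify.
Set Implicit Arguments.
Unset Strict Implicit.
Unset Printing Implicit Defensive.
Import Order.TTheory GRing.Theory Num.Theory.
Local Open Scope classical_set_scope.
Local Open Scope ring_scope.
Local Open Scope quotient_scope.

(** * Submodules and quotient modules *)

(** No weight decomposition of a module is ever built, and [delta] need not act semisimply. The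
    kernel of a polynomial in [delta] is only left exact as a functor; it becomes exact once the
    kernel and the image of [q(delta)] meet in 0 and together fill the module. This requires a
    nilpotency exponent common to all modules. It exists because a vector killed by a power of the
    lowest-weight polynomial [p] is killed by all degrees up to [-N0], with [N0] fixed by the
    integer differences of roots of [p]; one nonzero polynomial [g] annihilates all vectors killed
    in those degrees, and the gcds of [g] with the powers of [p] stop growing. In characteristic 0
    two nonzero polynomials have a common root after only finitely many integer shifts; this fact
    gives [N0], the finiteness of generalized kernels and the finiteness of the injectives.
    Submodules are finitely generated through the kernel of [q(delta)] instead of a noetherian
    property, and injectives come from coinduction instead of a duality of the category. Local
    nilpotence is traded for a condition on the grading of [A] alone. *)

Section LinearRelation.
Variables (A : pzRingType) (M N : lmodType A).

Definition linear_of (f : M -> N) (hf : linear f) : {linear M -> N} :=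
  HB.pack f (GRing.isLinear.Build A M N *:%R f hf).

Lemma linear_ofE (f : M -> N) (hf : linear f) x : linear_of hf x = f x.
Proof. by []. Qed.

Definition linear_relation (R : M -> N -> Prop) : Prop :=
  R 0 0 /\ forall a x u y v, R x u -> R y v -> R (a *: x + y) (a *: u + v).

(** Linear maps are built as graphs: two values at one point differ by a value at 0, so
    single-valuedness only has to be tested there. *)
Lemma linear_relation_fun (R : M -> N -> Prop) :
  linear_relation R -> (forall x, exists u, R x u) ->
  (forall u, R 0 u -> u = 0) ->
  exists h : {linear M -> N}, (forall x, R x (h x)) /\
    forall x u, R x u -> h x = u.
Proof.
move=> [R0 RL] tot sv.
have uni x u v : R x u -> R x v -> u = v.
  move=> xu xv; apply/eqP; rewrite -subr_eq0; apply/eqP/sv.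
  have := RL (-1) x v x u xv xu.
  by rewrite !scaleN1r addNr addrC.
have [f fP] := choice tot.
have hf : linear f.
  by move=> a x y; apply: (uni (a *: x + y)); [exact: fP|apply: RL; exact: fP].
exists (linear_of hf); split=> [x|x u xu]; first exact: fP.
exact: uni (fP x) xu.
Qed.

End LinearRelation.

Section Submodule.
Variables (A : pzRingType) (M : lmodType A) (S : set M).

Lemma submodP : submod_closed [in S] <->
  S 0 /\ forall a u v, S u -> S v -> S (a *: u + v).
Proof.
split=> -[S0 SL]; split; first by move: S0; rewrite inE.
- by move=> a u v Su Sv; apply/set_mem/SL; exact: mem_set.
- by rewrite inE.
- by move=> a u v; rewrite !inE; exact: SL.
Qed.

Hypothesis hS : submod_closed [in S].

Lemma submod0 : S 0. Proof. exact: (submodP.1 hS).1. Qed.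
Lemma submodL a u v : S u -> S v -> S (a *: u + v).
Proof. exact: (submodP.1 hS).2. Qed.
Lemma submodZ a u : S u -> S (a *: u).
Proof. by move=> /(submodL a)/(_ submod0); rewrite addr0. Qed.
Lemma submodD u v : S u -> S v -> S (u + v).
Proof. by move=> /(submodL 1)/[apply]; rewrite scale1r. Qed.
Lemma submodN u : S u -> S (- u).
Proof. by move=> /(submodZ (-1)); rewrite scaleN1r. Qed.
Lemma submodB u v : S u -> S v -> S (u - v).
Proof. by move=> Su /submodN; exact: submodD. Qed.
Lemma submod_sum (I : Type) (r : seq I) (P : pred I) (F : I -> M) :
  (forall i, P i -> S (F i)) -> S (\sum_(i <- r | P i) F i).
Proof. by move=> SF; apply: (big_ind S) => //; [exact: submod0|exact: submodD]. Qed.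
Lemma submod_sum_in (I : eqType) (r : seq I) (F : I -> M) :
  (forall i, i \in r -> S (F i)) -> S (\sum_(i <- r) F i).
Proof. by move=> SF; rewrite big_seq; exact: submod_sum. Qed.

Definition submod_pred of submod_closed [in S] : {pred M} := [in S].
HB.instance Definition _ := GRing.isSubmodClosed.Build A M (submod_pred hS) hS.

Definition submod_type := {x : M | submod_pred hS x}.
HB.instance Definition _ := SubChoice.on submod_type.
HB.instance Definition _ := [SubChoice_isSubLmodule of submod_type by <:].

Definition quotmod_type := Quotient.quot (submod_pred hS).
HB.instance Definition _ := GRing.Zmodule.on quotmod_type.

End Submodule.

Section SubmoduleTheory.
Variables (A : pzRingType) (M : lmodType A) (S : set M).
Hypothesis hS : submod_closed [in S].

Fact submod_val_linear : linear (val : submod_type hS -> M).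
Proof. by []. Qed.
Definition submod_val : {linear submod_type hS -> M} :=
  linear_of submod_val_linear.
Lemma submod_valP x : S (submod_val x).
Proof. exact/set_mem/(valP x). Qed.
Lemma submod_val_inj : injective submod_val. Proof. exact: val_inj. Qed.
Lemma submod_valK x : S x -> exists y, submod_val y = x.
Proof. by move=> /mem_set Sx; exists (exist _ x Sx). Qed.

Definition quot_pi (x : M) : quotmod_type hS := \pi_(Quotient.quot (submod_pred hS)) x.
Lemma quot_pi_eq x y : quot_pi x = quot_pi y <-> S (x - y).
Proof.
split => [/eqP|Sxy]; first by rewrite -Quotient.idealrBE => /set_mem.
by apply/eqP; rewrite -Quotient.idealrBE; exact: mem_set.
Qed.
Lemma quot_pi_surj z : exists x, quot_pi x = z.
Proof. by exists (repr z); rewrite /quot_pi reprK. Qed.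

Definition quot_scale (a : A) (z : quotmod_type hS) : quotmod_type hS :=
  quot_pi (a *: repr z).
Lemma quot_scale_pi a x : quot_scale a (quot_pi x) = quot_pi (a *: x).
Proof.
apply/quot_pi_eq; rewrite -scalerBr; apply: submodZ => //.
by apply/quot_pi_eq; rewrite /quot_pi reprK.
Qed.
Lemma quot_pi_add x y : quot_pi (x + y) = quot_pi x + quot_pi y.
Proof. by rewrite /quot_pi !piE. Qed.

Fact quot_scaleA a b v : quot_scale a (quot_scale b v) = quot_scale (a * b) v.
Proof.
by have [x <-] := quot_pi_surj v; rewrite !quot_scale_pi scalerA.
Qed.
Fact quot_scale1 : left_id 1 quot_scale.
Proof. by move=> v; have [x <-] := quot_pi_surj v; rewrite quot_scale_pi scale1r. Qed.
Fact quot_scaleDr : right_distributive quot_scale +%R.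
Proof.
move=> a v w; have [x <-] := quot_pi_surj v; have [y <-] := quot_pi_surj w.
by rewrite -quot_pi_add !quot_scale_pi scalerDr quot_pi_add.
Qed.
Fact quot_scaleDl v : {morph quot_scale^~ v : a b / a + b}.
Proof.
move=> a b; have [x <-] := quot_pi_surj v.
by rewrite !quot_scale_pi scalerDl quot_pi_add.
Qed.
HB.instance Definition _ := GRing.Zmodule_isLmodule.Build A (quotmod_type hS)
  quot_scaleA quot_scale1 quot_scaleDr quot_scaleDl.

Fact quot_pi_linear : linear quot_pi.
Proof. by move=> a x y; rewrite quot_pi_add -quot_scale_pi. Qed.
Definition quot_proj : {linear M -> quotmod_type hS} := linear_of quot_pi_linear.
Lemma quot_proj_surj z : exists x, quot_proj x = z.
Proof. exact: quot_pi_surj. Qed.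
Lemma quot_proj_eq0 x : quot_proj x = 0 <-> S x.
Proof. by rewrite -(linear0 quot_proj) quot_pi_eq subr0. Qed.

End SubmoduleTheory.

Section SubmoduleOperations.
Variables (A : pzRingType) (M N : lmodType A).

Lemma submod_ker (f : {linear M -> N}) :
  submod_closed [in [set x | f x = 0]].
Proof.
apply/submodP; split=> [|a u v /= fu fv]; first by rewrite /= linear0.
by rewrite linearP fu fv scaler0 addr0.
Qed.

Lemma submod_image (f : {linear M -> N}) (S : set M) :
  submod_closed [in S] -> submod_closed [in f @` S].
Proof.
move=> hS; apply/submodP; split=> [|a u v [x Sx <-] [y Sy <-]].
  by exists 0; rewrite ?linear0 //; exact: submod0.
by exists (a *: x + y); rewrite ?linearP //; exact: submodL.
Qed.

Lemma submod_preimage (f : {linear M -> N}) (S : set N) :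
  submod_closed [in S] -> submod_closed [in f @^-1` S].
Proof.
move=> hS; apply/submodP; split=> [|a u v /= Su Sv].
  by rewrite /= linear0; exact: submod0.
by rewrite linearP; exact: submodL.
Qed.

Lemma submod_setT : submod_closed [in [set: M]].
Proof. exact/submodP. Qed.

Lemma submod_set0 : submod_closed [in [set 0 : M]].
Proof. by apply/submodP; split=> // a u v -> ->; rewrite scaler0 addr0. Qed.

End SubmoduleOperations.

Section Factorization.
Variables (A : pzRingType) (X Y Z : lmodType A).

Lemma injective_factor (f : {linear X -> Y}) (g : {linear Z -> Y}) :
  injective f -> (forall z, exists x, f x = g z) ->
  exists h : {linear Z -> X}, forall z, f (h z) = g z.
Proof.
move=> injf fg; have [| |  |h [hP _]] := @linear_relation_fun A Z X
    (fun z x => f x = g z); [|exact: fg| |by exists h].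
  split=> [|a z x z' x' e e']; rewrite ?linear0 //.
  by rewrite !linearP e e'.
by move=> x; rewrite linear0 -(linear0 f) => /injf.
Qed.

Lemma surjective_factor (f : {linear X -> Y}) (g : {linear X -> Z}) :
  (forall y, exists x, f x = y) -> (forall x, f x = 0 -> g x = 0) ->
  exists h : {linear Y -> Z}, forall x, h (f x) = g x.
Proof.
move=> surf kfg; have [|||h [_ hP]] := @linear_relation_fun A Y Z
    (fun y z => exists x, f x = y /\ g x = z).
- split=> [|a y z y' z' [x [<- <-]] [x' [<- <-]]]; first by exists 0; rewrite !linear0.
  by exists (a *: x + x'); rewrite !linearP.
- by move=> y; have [x <-] := surf y; exists (g x), x.
- by move=> _ [x [/kfg-> <-]].
by exists h => x; apply: hP; exists x.
Qed.

End Factorization.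

(** * Full subcategories of modules *)

Section ModuleSubcategory.
Variables (A : pzRingType) (P : lmodType A -> Prop).
Local Notation C := (@full_subcategory (module_category A) P).

(** This closure keeps the kernels, cokernels and direct sums of modules inside the full
    subcategory, so its abelian structure is computed on modules. *)
Definition class_closed : Prop :=
  [/\ exists M, P M,
      forall (M : lmodType A) (S : set M) (hS : submod_closed [in S]),
        P M -> P (submod_type hS),
      forall (M : lmodType A) (S : set M) (hS : submod_closed [in S]),
        P M -> P (quotmod_type hS)
    & forall M N : lmodType A, P M -> P N -> P (M * N)%type].

Hypothesis hP : class_closed.

Let obj (M : lmodType A) (pM : P M) : Ob C := exist _ M pM.
Let carrier (X : Ob C) : lmodType A := sval X.

Lemma mor_ext (X Y : Ob C) (f g : Mor X Y) :
  (forall x, (f : {linear carrier X -> carrier Y}) x =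
             (g : {linear carrier X -> carrier Y}) x) -> f = g.
Proof. by move=> fg; apply: linear_ext. Qed.

Lemma mor_app (X Y : Ob C) (f g : Mor X Y) : f = g ->
  forall x, (f : {linear carrier X -> carrier Y}) x =
            (g : {linear carrier X -> carrier Y}) x.
Proof. by move=> ->. Qed.

Lemma zero_object_trivial (X : Ob C) :
  is_zero_object X <-> forall x : carrier X, x = 0.
Proof.
split=> [hX x|X0 Y].
  have [_ [f [_ uf]]] := hX X.
  have e : (idm X : Mor X X) = 0 by rewrite -(uf (idm X)) // -(uf 0).
  by have /= := (mor_app e x).
split; exists 0; split=> // f _; apply: mor_ext => y.
  by rewrite (X0 y) linear0 [RHS](linear0 (f : {linear carrier X -> carrier Y})).
exact/esym/X0.
Qed.

(** The inclusion of the module kernel serves as test morphism, since the class contains the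
    submodules of its members; the quotient by the range plays the dual role for epimorphisms. *)
Lemma mono_injective (X Y : Ob C) (f : Mor X Y) :
  is_mono f <-> injective (f : {linear carrier X -> carrier Y}).
Proof.
case: hP => _ hsub _ _; split=> [hf|injf Z g h fgh]; last first.
  apply: mor_ext => z; apply: injf.
  exact: (mor_app fgh z).
have hK := submod_ker (f : {linear carrier X -> carrier Y}).
pose K : Ob C := obj (hsub _ _ hK (svalP X)).
have e : (submod_val hK : Mor K X) = 0.
  apply: hf; apply: mor_ext => z; rewrite /= linear0; exact: (submod_valP z).
have {}e z : submod_val hK z = 0.
  exact: (mor_app e z).
move=> x y /eqP; rewrite -subr_eq0 -linearB => /eqP.
by move=> /(submod_valK hK)[z zE]; apply/eqP; rewrite -subr_eq0 -zE e.
Qed.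

Lemma epi_surjective (X Y : Ob C) (f : Mor X Y) :
  is_epi f <-> forall y, exists x,
    (f : {linear carrier X -> carrier Y}) x = y.
Proof.
case: hP => _ _ hquot _; split=> [hf|surf Z g h fgh]; last first.
  apply: mor_ext => y; have [x <-] := surf y.
  exact: (mor_app fgh x).
have hI := submod_image (f : {linear carrier X -> carrier Y})
  (@submod_setT A (carrier X)).
pose Q : Ob C := obj (hquot _ _ hI (svalP Y)).
have e : (quot_proj hI : Mor Y Q) = 0.
  by apply: hf; apply: mor_ext => x; apply/quot_proj_eq0; exists x.
move=> y; have /quot_proj_eq0[x _ <-] : quot_proj hI y = 0.
  exact: (mor_app e y).
by exists x.
Qed.

Lemma iso_bijective (X Y : Ob C) (f : Mor X Y) :
  injective (f : {linear carrier X -> carrier Y}) ->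
  (forall y, exists x, (f : {linear carrier X -> carrier Y}) x = y) -> is_iso f.
Proof.
move=> injf surf; have [g gP] := injective_factor (g := lin_id (carrier Y)) injf surf.
exists g; split; apply: mor_ext => x; last exact: (gP x).
by apply: injf; exact: (gP (f x)).
Qed.

Lemma iso_surjective (X Y : Ob C) (f : Mor X Y) : is_iso f ->
  forall y, exists x, (f : {linear carrier X -> carrier Y}) x = y.
Proof.
move=> [g [_ fg]] y; exists ((g : {linear carrier Y -> carrier X}) y).
exact: (mor_app fg y).
Qed.

Lemma kernel_of (X Y K : Ob C) (f : Mor X Y) (k : Mor K X) :
  injective (k : {linear carrier K -> carrier X}) ->
  (forall x, (f : {linear carrier X -> carrier Y}) x = 0 <->
    exists z, (k : {linear carrier K -> carrier X}) z = x) -> is_kernel f k.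
Proof.
move=> injk kP; split=> [|Z g fg].
  by apply: mor_ext => z /=; apply/kP; exists z.
have [z|h hE] := @injective_factor A _ _ (carrier Z) k g injk.
  by apply/kP; exact: (mor_app fg z).
exists h; split=> [|h' h'E]; apply: mor_ext => z; first exact: hE.
apply: injk; rewrite hE.
exact/esym/(mor_app h'E z).
Qed.

Lemma cokernel_of (X Y Q : Ob C) (f : Mor X Y) (q : Mor Y Q) :
  (forall z, exists y, (q : {linear carrier Y -> carrier Q}) y = z) ->
  (forall y, (q : {linear carrier Y -> carrier Q}) y = 0 <->
    exists x, (f : {linear carrier X -> carrier Y}) x = y) -> is_cokernel f q.
Proof.
move=> surq qP; split=> [|Z g gf].
  by apply: mor_ext => x /=; apply/qP; exists x.
have [|h hE] := @surjective_factor A _ _ (carrier Z) q g surq.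
  move=> y /qP[x <-].
  exact: (mor_app gf x).
exists h; split=> [|h' h'E]; apply: mor_ext => z; first exact: hE.
have [y <-] := surq z; rewrite hE.
exact/esym/(mor_app h'E y).
Qed.

Lemma pair_linear1 (M N : lmodType A) : linear (fun x : M => (x, 0 : N)).
Proof. by move=> a x y; apply/pair_equal_spec; rewrite /= scaler0 addr0. Qed.
Lemma pair_linear2 (M N : lmodType A) : linear (fun y : N => (0 : M, y)).
Proof. by move=> a x y; apply/pair_equal_spec; rewrite /= scaler0 addr0. Qed.
Lemma fst_linear (M N : lmodType A) : linear (fun x : M * N => x.1).
Proof. by []. Qed.
Lemma snd_linear (M N : lmodType A) : linear (fun x : M * N => x.2).
Proof. by []. Qed.

Theorem module_subcategory_abelian : is_abelian C.
Proof.
case: (hP) => -[M0 pM0] hsub hquot hprod.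
split; [|split; [|split; [|split; [|split]]]].
- exists (obj (hsub _ _ (@submod_set0 A M0) pM0)).
  apply/zero_object_trivial => x; apply: (@submod_val_inj _ _ _ (submod_set0 M0)).
  by rewrite linear0; exact: (submod_valP x).
- move=> X Y; exists (obj (hprod _ _ (svalP X) (svalP Y))).
  exists (linear_of (@pair_linear1 (carrier X) (carrier Y))).
  exists (linear_of (@pair_linear2 (carrier X) (carrier Y))).
  exists (linear_of (@fst_linear (carrier X) (carrier Y))).
  exists (linear_of (@snd_linear (carrier X) (carrier Y))).
  split; apply: mor_ext => //.
  by move=> [x y]; apply/pair_equal_spec; rewrite /= addr0 add0r.
- move=> X Y f; have hK := submod_ker (f : {linear carrier X -> carrier Y}).
  exists (obj (hsub _ _ hK (svalP X))), (submod_val hK).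
  apply: kernel_of => [|x]; first exact: submod_val_inj.
  by split=> [/(submod_valK hK)//|[z <-]]; exact: (submod_valP z).
- move=> X Y f; have hI := submod_image (f : {linear carrier X -> carrier Y})
    (@submod_setT A (carrier X)).
  exists (obj (hquot _ _ hI (svalP Y))), (quot_proj hI).
  apply: cokernel_of => [|y]; first exact: quot_proj_surj.
  by split=> [/quot_proj_eq0[x _ <-]|[x <-]]; [exists x|apply/quot_proj_eq0; exists x].
- move=> X Y f /mono_injective injf.
  have hI := submod_image (f : {linear carrier X -> carrier Y})
    (@submod_setT A (carrier X)).
  exists (obj (hquot _ _ hI (svalP Y))), (quot_proj hI).
  apply: kernel_of => // y.
  by split=> [/quot_proj_eq0[x _ <-]|[x <-]]; [exists x|apply/quot_proj_eq0; exists x].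
- move=> X Y f /epi_surjective surf.
  have hK := submod_ker (f : {linear carrier X -> carrier Y}).
  exists (obj (hsub _ _ hK (svalP X))), (submod_val hK).
  apply: cokernel_of => // x.
  by split=> [/(submod_valK hK)//|[z <-]]; exact: (submod_valP z).
Qed.

Definition simple_module (M : lmodType A) : Prop :=
  (exists x : M, x <> 0) /\
  forall S : set M, submod_closed [in S] -> S = [set 0] \/ S = setT.

Lemma simple_module_simple (X : Ob C) : simple_module (carrier X) -> is_simple X.
Proof.
move=> [[x x0] simX]; split=> [/zero_object_trivial X0|Y f /mono_injective injf].
  by case: x0; exact: X0.
have [f0|fT] := simX _ (submod_image (f : {linear carrier Y -> carrier X})
  (@submod_setT A (carrier Y))).
  left; apply/zero_object_trivial => y; apply: injf; rewrite linear0.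
  by have : [set 0] ((f : {linear carrier Y -> carrier X}) y) by rewrite -f0; exists y.
right; apply: iso_bijective => // z.
have [y _ <-] : (range (f : {linear carrier Y -> carrier X})) z by rewrite fT.
by exists y.
Qed.

Lemma simple_simple_module (X : Ob C) : is_simple X -> simple_module (carrier X).
Proof.
case: hP => _ hsub _ _ [X0 simX]; split.
  apply: contrapT => /forallNP X0'; apply: X0; apply/zero_object_trivial => x.
  by apply: contrapT; exact: X0'.
move=> S hS; have [|S0|Siso] := simX (obj (hsub _ _ hS (svalP X))) (submod_val hS).
- by apply/mono_injective; exact: submod_val_inj.
- left; apply/seteqP; split=> [x Sx|_ ->]; last exact: submod0.
  have [y <-] := submod_valK hS Sx.
  by rewrite ((zero_object_trivial _).1 S0 y) linear0.
- right; apply/seteqP; split=> // x _.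
  by have [y <-] := iso_surjective Siso x; exact: (submod_valP y).
Qed.

(** All terms are subsets of one module, so no isomorphisms need tracking. Inclusions are asked at
    every index because [has_finite_length] wants morphisms at every index; strictness and
    maximality only below [n]. *)
Definition composition_chain (M : lmodType A) n (c : nat -> set M) : Prop :=
  [/\ forall k, submod_closed [in c k], c 0%N = [set 0],
      forall k, c k `<=` c k.+1
    & forall k, (k < n)%N -> c k <> c k.+1 /\
      forall S : set M, submod_closed [in S] -> c k `<=` S -> S `<=` c k.+1 ->
        S = c k \/ S = c k.+1].

Section Chain.
Variables (M : lmodType A) (pM : P M) (n : nat) (c : nat -> set M).
Hypothesis chain : composition_chain n c.

Fact chain_submod k : submod_closed [in c k].
Proof. by case: chain. Qed.

Definition chain_below k : set (submod_type (chain_submod k.+1)) :=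
  submod_val (chain_submod k.+1) @^-1` (c k).
Arguments chain_below k : clear implicits.

Fact chain_below_submod k : submod_closed [in chain_below k].
Proof. exact: (submod_preimage _ (chain_submod k)). Qed.

Lemma chain_factor_simple k : (k < n)%N ->
  simple_module (quotmod_type (chain_below_submod k)).
Proof.
case: chain => _ _ cS csimple /csimple[cneq cmax]; split.
  have [x cx ncx] : exists2 x, c k.+1 x & ~ c k x.
    apply: contrapT => no; apply: cneq; apply/seteqP; split=> [|x cx].
      exact: cS.
    by apply: contrapT => ncx; apply: no; exists x.
  have [y yx] := submod_valK (chain_submod k.+1) cx.
  by exists (quot_proj (chain_below_submod k) y) => /quot_proj_eq0 cy;
  apply: ncx; rewrite -yx.
(* A submodule of the factor is pulled back to [c k.+1] and pushed into [M], where the maximality of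
   [c k] applies. *)
move=> S hS; pose S' := submod_val (chain_submod k.+1) @`
  (quot_proj (chain_below_submod k) @^-1` S).
have hS' : submod_closed [in S'] by exact/submod_image/submod_preimage.
have [||S'E|S'E] := cmax _ hS'.
- move=> x cx; have [y yx] := submod_valK (chain_submod k.+1) (cS _ _ cx).
  exists y => //; suff : S (quot_proj (chain_below_submod k) y) by [].
  rewrite (_ : quot_proj _ y = 0); first exact: submod0.
  apply/quot_proj_eq0; suff : c k (submod_val (chain_submod k.+1) y) by [].
  by rewrite yx.
- by move=> _ [y _ <-]; exact: (submod_valP y).
- left; apply/seteqP; split=> [z Sz|_ ->]; last exact: submod0.
  have [y yz] := quot_proj_surj z; rewrite -{}yz in Sz *.
  apply/quot_proj_eq0; suff : c k (submod_val (chain_submod k.+1) y) by [].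
  by rewrite -S'E; exists y.
- right; apply/seteqP; split=> // z _.
  have [y <-] := quot_proj_surj z.
  have [y' Sy' /(@submod_val_inj _ _ _ (chain_submod k.+1)) <-] :
    S' (submod_val (chain_submod k.+1) y).
    by rewrite S'E; exact: (submod_valP y).
  exact: Sy'.
Qed.

Lemma chain_finite_length : c n = setT -> has_finite_length (obj pM).
Proof.
move=> cT; case: (hP) => _ hsub hquot _; case: chain => _ c0 cS csimple.
pose F k : Ob C := obj (hsub _ _ (chain_submod k) pM).
have incl k : exists i : {linear submod_type (chain_submod k) ->
      submod_type (chain_submod k.+1)},
    forall x, submod_val (chain_submod k.+1) (i x) = submod_val (chain_submod k) x.
  apply: injective_factor => [|z]; first exact: submod_val_inj.
  by apply/submod_valK/cS; exact: (submod_valP z).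
pose i k : Mor (F k) (F k.+1) := sval (cid (incl k)).
have iP k x : submod_val (chain_submod k.+1)
    ((i k : {linear carrier (F k) -> carrier (F k.+1)}) x) =
    submod_val (chain_submod k) x by exact: (svalP (cid (incl k)) x).
exists n, F, i; split=> [| |k kn].
- apply/zero_object_trivial => x; apply: (@submod_val_inj _ _ _ (chain_submod 0)).
  rewrite linear0; suff : [set 0] (submod_val (chain_submod 0) x) by [].
  by rewrite -c0; exact: (submod_valP x).
- exists (submod_val (chain_submod n)); apply: iso_bijective => [|y].
    exact: submod_val_inj.
  by apply: submod_valK; rewrite cT.
split.
  apply/mono_injective => x y e; apply: (@submod_val_inj _ _ _ (chain_submod k)).
  by rewrite -(iP k x) -(iP k y) e.
exists (obj (hquot _ _ (chain_below_submod k) (hsub _ _ (chain_submod k.+1) pM))).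
exists (quot_proj (chain_below_submod k)); split.
  exact/simple_module_simple/chain_factor_simple.
apply: cokernel_of => [|y]; first exact: quot_proj_surj.
split=> [/quot_proj_eq0 cy|[x <-]]; last first.
  apply/quot_proj_eq0; suff : c k (submod_val (chain_submod k.+1)
    ((i k : {linear carrier (F k) -> carrier (F k.+1)}) x)) by [].
  by rewrite iP; exact: (submod_valP x).
have [x xy] := submod_valK (chain_submod k) cy.
by exists x; apply: (@submod_val_inj _ _ _ (chain_submod k.+1)); rewrite iP.
Qed.

(* A nonzero map from [M] to a simple object is nonzero on a first term of the
   chain, hence identifies the simple object with a factor of the chain. *)
Lemma chain_finitely_many_simples : c n = setT ->
  (forall X : Ob C, is_simple X ->
     exists f : {linear M -> carrier X}, exists x, f x <> 0) ->
  finitely_many_simples C.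
Proof.
move=> cT hom; case: (hP) => _ hsub hquot _; case: chain => _ c0 cS _.
exists n, (fun j : 'I_n =>
  obj (hquot _ _ (chain_below_submod j) (hsub _ _ (chain_submod j.+1) pM))).
split=> [j|X simX]; first exact/simple_module_simple/chain_factor_simple.
have [f [x fx]] := hom X simX.
pose Q k := `[< exists2 y, c k y & f y <> 0 >].
have Q1 : exists k, Q k by exists n; apply/asboolP; exists x; rewrite ?cT.
case: (ex_minnP Q1) => -[|k] /asboolP[y cy fy] kmin.
  by move: cy fy; rewrite c0 => ->; rewrite linear0.
have kn : (k < n)%N by apply: kmin; apply/asboolP; exists x; rewrite ?cT.
have fk z : c k z -> f z = 0.
  move=> cz; apply: contrapT => fz; have /kmin : Q k by apply/asboolP; exists z.
  by rewrite ltnn.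
pose g := lin_comp f (submod_val (chain_submod k.+1)).
have [u uy] := submod_valK (chain_submod k.+1) cy.
have [h hE] : exists h : {linear quotmod_type (chain_below_submod k) -> carrier X},
    forall z, h (quot_proj (chain_below_submod k) z) = g z.
  apply: surjective_factor => [|z /quot_proj_eq0]; first exact: quot_proj_surj.
  exact: fk.
have hu : h (quot_proj (chain_below_submod k) u) <> 0.
  rewrite hE; suff : f (submod_val (chain_submod k.+1) u) <> 0 by [].
  by rewrite uy.
have [_ simX'] := simple_simple_module simX.
have surh z : exists w, h w = z.
  have [h0|hT] := simX' _ (submod_image h (@submod_setT _ _)).
    case: hu; suff : [set 0] (h (quot_proj (chain_below_submod k) u)) by [].
    by rewrite -h0; exists (quot_proj (chain_below_submod k) u).
  have [w _ <-] : range h z by rewrite hT.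
  by exists w.
have injh : injective h.
  have [_ simQ] := chain_factor_simple kn.
  have [k0|kT] := simQ _ (submod_ker h); last first.
    case: hu; suff : [set w | h w = 0] (quot_proj (chain_below_submod k) u) by [].
    by rewrite kT.
  move=> a b ab; apply/eqP; rewrite -subr_eq0; apply/eqP.
  suff : [set w | h w = 0] (a - b) by rewrite k0.
  by rewrite /= linearB ab subrr.
exists (Ordinal kn).
have [h' [hh' h'h]] : @is_iso C (obj (hquot _ _ (chain_below_submod k)
  (hsub _ _ (chain_submod k.+1) pM))) X h by exact: iso_bijective.
by exists h'; exists h.
Qed.

End Chain.

End ModuleSubcategory.

(** * Finite dimensional subspaces *)

Section FiniteDimension.
Variable K : fieldType.
Implicit Types V U : lmodType K.

Definition lin_span V (X : set V) : set V :=
  smallest (fun S : set V => submod_closed [in S]) X.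

Lemma lin_span_submod V (X : set V) : submod_closed [in lin_span X].
Proof.
apply/submodP; split=> [S [hS _]|a u v Xu Xv S [hS XS]]; first exact: submod0.
by apply: submodL => //; [exact: Xu|exact: Xv].
Qed.

Lemma lin_span_sub V (X S : set V) : submod_closed [in S] ->
  X `<=` S -> lin_span X `<=` S.
Proof. by move=> hS XS x; apply. Qed.

Lemma lin_span_gen V (X : set V) : X `<=` lin_span X.
Proof. by move=> x Xx S [_]; apply. Qed.

Fact lin_comb_linear V n (e : 'I_n -> V) :
  linear (fun c : 'rV[K]_n => \sum_(j < n) c 0 j *: e j).
Proof.
move=> a c d; rewrite scaler_sumr -big_split /=; apply: eq_bigr => j _.
by rewrite !mxE scalerDl scalerA.
Qed.
Definition lin_comb V n (e : 'I_n -> V) : {linear 'rV[K]_n -> V} :=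
  linear_of (lin_comb_linear e).

Lemma lin_combE V n (e : 'I_n -> V) c : lin_comb e c = \sum_(j < n) c 0 j *: e j.
Proof. by []. Qed.

Definition fam_span V n (e : 'I_n -> V) : set V := range (lin_comb e).

Lemma fam_span_submod V n (e : 'I_n -> V) : submod_closed [in fam_span e].
Proof. exact/submod_image/submod_setT. Qed.

Lemma fam_span_gen V n (e : 'I_n -> V) j : fam_span e (e j).
Proof.
exists (delta_mx 0 j) => //; rewrite lin_combE (bigD1 j) //= mxE !eqxx scale1r.
by rewrite big1 ?addr0 // => k kj; rewrite mxE (negPf kj) andbF scale0r.
Qed.

Lemma fam_spanP V n (e : 'I_n -> V) x :
  fam_span e x <-> exists c : 'I_n -> K, x = \sum_(j < n) c j *: e j.
Proof.
split=> [[c _ <-]|[c ->]]; first by exists (c 0).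
exists (\row_j c j) => //; rewrite lin_combE.
by apply: eq_bigr => j _; rewrite mxE.
Qed.

Lemma fam_span_sub V n (e : 'I_n -> V) (S : set V) : submod_closed [in S] ->
  (forall j, S (e j)) -> fam_span e `<=` S.
Proof.
move=> hS eS _ /fam_spanP[c ->]; apply: submod_sum => // j _; exact: submodZ.
Qed.

(** The ambient space may be infinite dimensional, so dimension enters only as a bound on the length
    of a family whose span contains [S]. *)
Definition rank_le V (S : set V) n := exists e : 'I_n -> V, S `<=` fam_span e.

Lemma lin_span_seq V (s : seq V) : rank_le (lin_span [set` s]) (size s).
Proof.
exists (fun j => s`_j); apply: lin_span_sub => [|x /= xs].
  exact: fam_span_submod.
rewrite -(nth_index 0 xs); move: (xs); rewrite -index_mem => lt.
exact: (fam_span_gen (fun j : 'I_(size s) => s`_j) (Ordinal lt)).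
Qed.

Lemma rank_le_sub V (S S' : set V) n : S `<=` S' -> rank_le S' n -> rank_le S n.
Proof. by move=> SS' [e eP]; exists e => x /SS'/eP. Qed.

(** A subspace of largest dimension inside [U] is all of [U], since otherwise one more line could be
    added to it. *)
Lemma row_submodule n (U : set 'rV[K]_n) : submod_closed [in U] ->
  exists W : {vspace 'rV[K]_n}, forall x, U x <-> x \in W.
Proof.
move=> hU; pose P d := `[< exists W : {vspace 'rV[K]_n},
  (forall x, x \in W -> U x) /\ \dim W = d >].
have P0 : exists d, P d.
  exists 0%N; apply/asboolP; exists 0%VS; split; last exact: dimv0.
  by move=> x; rewrite memv0 => /eqP ->; exact: submod0.
have Pub d : P d -> (d <= n)%N.
  move=> /asboolP[W [_ <-]]; apply: leq_trans (dimvS (subvf W)) _.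
  by rewrite dimvf /dim /= mul1n.
case: (ex_maxnP P0 Pub) => d /asboolP[W [WU dW]] dmax.
exists W => x; split=> [Ux|]; last exact: WU.
apply: contrapT => /negP xW.
have : P (\dim (W + <[x]>)%VS).
  apply/asboolP; exists (W + <[x]>)%VS; split=> // y /memv_addP[u uW [v vx ->]].
  apply: submodD => //; first exact: WU.
  by move: vx => /vlineP[k ->]; exact: submodZ.
move=> /dmax; rewrite -dW => le.
have : W == (W + <[x]>)%VS by rewrite eqEdim addvSl.
move=> /eqP WE; move: xW; rewrite WE => /negP; apply.
exact: (subvP (addvSr _ _)) (memv_line x).
Qed.

Lemma fam_span_submodule V n (e : 'I_n -> V) (S : set V)
    (W : {vspace 'rV[K]_n}) :
  submod_closed [in S] -> S `<=` fam_span e ->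
  (forall c, S (lin_comb e c) <-> c \in W) ->
  exists e' : 'I_(\dim W) -> V, S = fam_span e'.
Proof.
move=> hS Se WP; pose e' (i : 'I_(\dim W)) := lin_comb e (vbasis W)`_i.
exists e'; apply/seteqP; split=> [x Sx|]; last first.
  apply: fam_span_sub => // j; apply/WP/vbasis_mem.
  by apply: mem_nth; rewrite size_tuple.
have [c _ xE] := Se x Sx; have /WP cW : S (lin_comb e c) by rewrite xE.
rewrite -xE (coord_vbasis cW) linear_sum; apply: submod_sum => [|i _].
  exact: fam_span_submod.
by rewrite linearZ; apply: submodZ; [exact: fam_span_submod|exact: fam_span_gen].
Qed.

Lemma dimv_row n (W : {vspace 'rV[K]_n}) : (\dim W <= n)%N.
Proof.
apply: leq_trans (dimvS (subvf W)) _; by rewrite dimvf /dim /= mul1n.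
Qed.

Lemma rank_le_submod V (S : set V) n : submod_closed [in S] -> rank_le S n ->
  exists2 m, (m <= n)%N & exists e : 'I_m -> V, S = fam_span e.
Proof.
move=> hS [e Se].
have [W WP] := row_submodule (submod_preimage (lin_comb e) hS).
by exists (\dim W); [exact: dimv_row|exact: (fam_span_submodule hS Se)].
Qed.

(** In coordinates for [S] the preimage of [S'] misses a row, so its dimension is strictly smaller.
    This strict drop is what makes composition series terminate. *)
Lemma rank_le_proper V (S S' : set V) n : submod_closed [in S] ->
  submod_closed [in S'] -> S' `<=` S -> (exists2 x, S x & ~ S' x) ->
  rank_le S n -> exists2 m, (m < n)%N & rank_le S' m.
Proof.
move=> hS hS' S'S [x Sx S'x] /(rank_le_submod hS)[m mn [e SE]].
have [W WP] := row_submodule (submod_preimage (lin_comb e) hS').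
have [c _ xE] : fam_span e x by rewrite -SE.
exists (\dim W); last first.
  have [|e' ->] := fam_span_submodule hS' _ WP; last by exists e'.
  by move=> y /S'S; rewrite SE.
apply: leq_trans mn; rewrite ltn_neqAle dimv_row andbT.
apply/eqP => dW; apply: S'x; rewrite -xE; apply/WP.
suff -> : W = fullv by rewrite memvf.
by apply/eqP; rewrite eqEdim subvf dW dimvf /dim /= mul1n.
Qed.

Lemma rank_le_injective V (S : set V) n (f : {linear V -> 'rV[K]_n}) :
  submod_closed [in S] -> (forall x, S x -> f x = 0 -> x = 0) -> rank_le S n.
Proof.
move=> hS injf; have [W WP] := row_submodule (submod_image f hS).
have preim (i : 'I_(\dim W)) : exists x, S x /\ f x = (vbasis W)`_i.
  have /WP[x Sx xE] : (vbasis W)`_i \in W.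
    by apply/vbasis_mem/mem_nth; rewrite size_tuple.
  by exists x.
have [e eP] := choice preim.
suff : rank_le S (\dim W).
  (* The family of length [\dim W] is padded with zeros to length [n]. *)
  move=> [e' Se']; pose g (i : 'I_n) := oapp e' 0 (insub (i : nat)).
  exists g => x /Se'; apply: fam_span_sub => [|j]; first exact: fam_span_submod.
  have lt : (j < n)%N by exact: leq_trans (ltn_ord j) (dimv_row W).
  have -> : e' j = g (Ordinal lt).
    by rewrite /g insubT //= => lt'; congr e'; exact: val_inj.
  exact: fam_span_gen.
exists e => x Sx; apply/fam_spanP.
exists (fun i => coord (vbasis W) i (f x)); apply/eqP; rewrite -subr_eq0.
apply/eqP/injf.
  by apply: submodB => //; apply: submod_sum => // i _; apply: submodZ => //; case: (eP i).
have fxW : f x \in W by apply/WP; exists x.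
rewrite linearB linear_sum /= {1}(coord_vbasis fxW).
apply/eqP; rewrite subr_eq0; apply/eqP/eq_bigr => i _.
by rewrite linearZ /=; case: (eP i) => _ ->.
Qed.

(** A partial linear map [R] whose domain has finite codimension extends to a total one that still
    selects its values in [Q]. The vectors of [e] span a supplement of the domain and are adjoined
    one at a time, which avoids Zorn's lemma. *)
Lemma linear_selection V U (Q R : V -> U -> Prop) n (e : 'I_n -> V) :
  linear_relation Q -> linear_relation R ->
  (forall x, exists u, Q x u) -> (forall x u, R x u -> Q x u) ->
  (forall u, R 0 u -> u = 0) ->
  (forall x, exists y u, R y u /\ fam_span e (x - y)) ->
  exists h : {linear V -> U}, (forall x, Q x (h x)) /\
    forall x u, R x u -> h x = u.
Proof.
move=> QL; elim: n e R => [|n IHn] e R RL Qtot RQ R1 Re.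
  have [||h [hR hE]] := @linear_relation_fun K V U R RL; last first.
  - by exists h; split=> // x; exact/RQ/hR.
  - exact: R1.
  move=> x; have [y [u [Ryu /fam_spanP[c]]]] := Re x; rewrite big_ord0.
  by move=> /eqP; rewrite subr_eq0 => /eqP ->; exists u.
have [u0 Qu0] := Qtot (e ord0).
have [[u1 Ru1]|noR] := pselect (exists u1, R (e ord0) u1).
  apply: (IHn (fun j => e (lift ord0 j)) R) => // x.
  have [y [u [Ryu /fam_spanP[c xE]]]] := Re x.
  exists (c ord0 *: e ord0 + y), (c ord0 *: u1 + u); split; first exact: RL.2.
  apply/fam_spanP; exists (fun j => c (lift ord0 j)).
  by move: xE; rewrite big_ord_recl opprD addrCA addrC => ->; rewrite addrAC subrr add0r.
(* [R'] is [R] with the pair [(e ord0, u0)] adjoined. *)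
pose R' x u := exists c, R (x - c *: e ord0) (u - c *: u0).
have RR' x u : R x u -> R' x u by exists 0; rewrite !scale0r !subr0.
have R'L : linear_relation R'.
  split=> [|a x u y v [c Rc] [d Rd]]; first exact/RR'/RL.1.
  exists (a * c + d); have := RL.2 a _ _ _ _ Rc Rd.
  have E (W : lmodType K) (s t w : W) :
    a *: (s - c *: w) + (t - d *: w) = a *: s + t - (a * c + d) *: w.
    by rewrite scalerBr scalerA addrACA -opprD -scalerDl.
  by rewrite !E.
have [|||h [hQ hR']] := IHn (fun j => e (lift ord0 j)) R' R'L Qtot; last first.
- by exists h; split=> // x u /RR'; exact: hR'.
- move=> x; have [y [u [Ryu /fam_spanP[c xE]]]] := Re x.
  exists (c ord0 *: e ord0 + y), (c ord0 *: u0 + u); split.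
    by exists (c ord0); rewrite ![_ *: _ + _]addrC !addrK.
  apply/fam_spanP; exists (fun j => c (lift ord0 j)).
  by move: xE; rewrite big_ord_recl opprD addrCA addrC => ->; rewrite addrAC subrr add0r.
- move=> u [c Rc]; have [c0|c0] := eqVneq c 0.
    by move: Rc; rewrite c0 !scale0r !subr0; exact: R1.
  (* A nonzero [c] would put a nonzero multiple of [e ord0], hence [e ord0] itself, in the domain of
     [R]. *)
  case: noR; exists (- c^-1 *: (u - c *: u0)).
  have := RL.2 (- c^-1) _ _ _ _ Rc RL.1.
  by rewrite sub0r !addr0 scalerN scaleNr opprK scalerA mulVf // scale1r.
- move=> x u [c /RQ Qc]; have := QL.2 c _ _ _ _ Qu0 Qc.
  by rewrite ![c *: _ + _]addrC !subrK.
Qed.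

End FiniteDimension.

(** * Restriction of scalars from [A] to [K] *)

Section Restriction.
Variables (K : fieldType) (A : algType K).

(* An A-module with its scalars restricted to K. *)
Definition Kmodule (M : lmodType A) : Type := M.
Section Instances.
Variable M : lmodType A.
HB.instance Definition _ := GRing.Zmodule.on (Kmodule M).
Definition Kmodule_scale (c : K) (x : Kmodule M) : Kmodule M :=
  (c%:A : A) *: (x : M).
Fact Kmodule_scaleA a b v :
  Kmodule_scale a (Kmodule_scale b v) = Kmodule_scale (a * b) v.
Proof. by rewrite /Kmodule_scale scalerA -scalerAl mul1r scalerA. Qed.
Fact Kmodule_scale1 : left_id 1 Kmodule_scale.
Proof. by move=> v; rewrite /Kmodule_scale scale1r scale1r. Qed.
Fact Kmodule_scaleDr : right_distributive Kmodule_scale +%R.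
Proof. by move=> a v w; exact: scalerDr. Qed.
Fact Kmodule_scaleDl v : {morph Kmodule_scale^~ v : a b / a + b}.
Proof. by move=> a b; rewrite /Kmodule_scale scalerDl; exact: scalerDl. Qed.
HB.instance Definition _ := GRing.Zmodule_isLmodule.Build K (Kmodule M)
  Kmodule_scaleA Kmodule_scale1 Kmodule_scaleDr Kmodule_scaleDl.
End Instances.

Lemma Kmodule_scaleE (M : lmodType A) (c : K) (x : Kmodule M) :
  c *: x = (c%:A : A) *: (x : M).
Proof. by []. Qed.

Lemma Kmodule_submod (M : lmodType A) (S : set M) :
  submod_closed [in S] -> submod_closed [in (S : set (Kmodule M))].
Proof.
move=> hS; apply/submodP; split=> [|a u v Su Sv]; first exact: submod0 hS.
exact: (submodL hS).
Qed.

Fact act_linear (M : lmodType A) (x : M) :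
  linear ((fun a => a *: x) : A -> Kmodule M).
Proof.
move=> c a b; rewrite [LHS]scalerDl; congr (_ + _).
by rewrite Kmodule_scaleE scalerA -scalerAl mul1r.
Qed.
Definition act (M : lmodType A) (x : M) : {linear A -> Kmodule M} :=
  linear_of (act_linear x).
Lemma actE (M : lmodType A) (x : M) a : act x a = a *: x. Proof. by []. Qed.

Fact lact_linear (M : lmodType A) (a : A) :
  (forall c : K, a * c%:A = c%:A * a) ->
  linear ((fun x => a *: x) : Kmodule M -> Kmodule M).
Proof.
by move=> ac c x y; rewrite !Kmodule_scaleE scalerDr !scalerA ac.
Qed.

Lemma finite_dimensionalP (M : lmodType A) (S : set M) n :
  submod_closed [in (S : set (Kmodule M))] ->
  rank_le (S : set (Kmodule M)) n -> finite_dimensional S.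
Proof.
move=> hS /(rank_le_submod hS)[m _ [e SE]]; exists m, e.
rewrite SE; apply/seteqP; split=> x.
  by move=> /fam_spanP[c ->]; exists c.
by move=> [c ->]; apply/fam_spanP; exists c.
Qed.

Lemma lin_span_mul (X Y P : set A) : submod_closed [in P] ->
  (forall x y, X x -> Y y -> P (x * y)) ->
  forall x y, lin_span X x -> lin_span Y y -> P (x * y).
Proof.
move=> hP XYP x y Xx Yy.
have : lin_span X `<=` [set x | P (x * y)].
  apply: lin_span_sub => [|x' Xx' /=].
    apply/submodP; split=> [|a u v /= Pu Pv]; first by rewrite /= mul0r; exact: submod0.
    by rewrite /= mulrDl -scalerAl; exact: submodL.
  have : lin_span Y `<=` [set y | P (x' * y)]; last exact.
  apply: lin_span_sub => [|y' Yy' /=]; last exact: XYP.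
  apply/submodP; split=> [|a u v /= Pu Pv]; first by rewrite /= mulr0; exact: submod0.
  by rewrite /= mulrDr -scalerAr; exact: submodL.
exact.
Qed.

End Restriction.

(** * Graded algebras and triangular decompositions *)

Section Projections.
Variables (K : fieldType) (A : algType K) (G : int -> set A).
Hypothesis gradedA : algebra_grading G.

Lemma grading_submod m : submod_closed [in G m].
Proof. by case: gradedA. Qed.
Lemma grading1 : G 0 1.
Proof. by case: gradedA. Qed.
Lemma gradingM m n a b : G m a -> G n b -> G (m + n) (a * b).
Proof. by case: gradedA => _ _ _ _; apply. Qed.

Lemma sum_fset_widen (s t : {fset int}) (f : int -> A) :
  {subset s <= t} -> (forall k, k \notin s -> f k = 0) ->
  \sum_(k <- t) f k = \sum_(k <- s) f k.
Proof.
move=> st f0; rewrite (bigID (fun k => k \in s)) /= [X in _ + X]big1 ?addr0 //.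
rewrite -big_filter; apply: perm_big; apply: uniq_perm.
- by rewrite filter_uniq ?fset_uniq.
- exact: fset_uniq.
move=> k; rewrite mem_filter; apply/andP/idP => [[]//|ks].
by split=> //; exact: st.
Qed.

(** [f] is total and zero off [s], so that decompositions with different supports can be added. *)
Definition decomposition (a : A) (s : {fset int}) (f : int -> A) : Prop :=
  [/\ forall k, G k (f k), forall k, k \notin s -> f k = 0
    & a = \sum_(k <- s) f k].

Definition graded_projection (pi : int -> {linear A -> A}) : Prop :=
  [/\ forall m a, G m (pi m a),
      forall m n a, G n a -> pi m a = if m == n then a else 0
    & forall a, exists s : seq int, a = \sum_(k <- s) pi k a].

(** Sending [a] to the degree [m] term of a decomposition is a linear relation; independence says
    that a decomposition of 0 is zero, which makes it a function. *)
Lemma graded_projection_exists : exists pi, graded_projection pi.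
Proof.
have decP a : exists s f, decomposition a s f.
  have [_ GT _ _ _] := gradedA; have [s [f [sf ->]]] : graded_sum G predT a by rewrite GT.
  exists s, (fun k => if k \in s then f k else 0); split=> [k|k /negPf->//|].
    by case: ifPn => [/sf[]//|_]; exact: submod0 (grading_submod k).
  by rewrite !big_seq; apply: eq_bigr => k ->.
have decL c a s f b t g : decomposition a s f -> decomposition b t g ->
    decomposition (c *: a + b) (s `|` t)%fset (fun k => c *: f k + g k).
  move=> [Gf f0 ->] [Gg g0 ->]; split=> [k|k|].
  - exact: (submodL (grading_submod k)).
  - by rewrite in_fsetU negb_or => /andP[/f0-> /g0->]; rewrite scaler0 addr0.
  - rewrite big_split /= -scaler_sumr.
    have su : {subset s <= (s `|` t)%fset} by move=> k; rewrite in_fsetU => ->.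
    have tu : {subset t <= (s `|` t)%fset}.
      by move=> k; rewrite in_fsetU orbC => ->.
    by rewrite (sum_fset_widen su f0) (sum_fset_widen tu g0).
have dec0 s f : decomposition 0 s f -> forall k, f k = 0.
  move=> [Gf f0 e] k; have [ks|/f0//] := boolP (k \in s).
  by have [_ _ ind _ _] := gradedA; exact: (ind s f).
have piP m : exists h : {linear A -> A}, forall a s f, decomposition a s f ->
    h a = f m.
  have [| | |h [_ hP]] := @linear_relation_fun K A A
      (fun a u => exists s f, decomposition a s f /\ f m = u).
  - split=> [|c a _ b _ [s [f [df <-]]] [t [g [dg <-]]]].
      exists fset0, (fun=> 0); split=> //; split=> //.
        by move=> k; exact: submod0 (grading_submod k).
      by rewrite big1.
    by do 2 eexists; split; [exact: decL df dg|].
  - by move=> a; have [s [f df]] := decP a; exists (f m), s, f.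
  - by move=> _ [s [f [/dec0 df <-]]].
  by exists h => a s f df; apply: hP; exists s, f.
have [pi pisum] := choice piP; exists pi; split=> [m a|m n a Ga|a].
- by have [s [f df]] := decP a; rewrite (pisum _ _ _ _ df); case: df.
- rewrite (pisum m a [fset n]%fset (fun k => if k == n then a else 0)) //.
  split=> [k|k|]; last by rewrite big_seq_fset1 eqxx.
    by case: eqP => [->|_] //; exact: submod0 (grading_submod k).
  by rewrite inE => /negPf->.
- have [s [f df]] := decP a; exists s; case: (df) => _ _ {1}->.
  by apply: eq_bigr => k _; rewrite (pisum _ _ _ _ df).
Qed.

End Projections.

(** * Words in homogeneous generators *)

Section Words.
Variables (K : fieldType) (A : algType K) (G : int -> set A).
Hypothesis gradedA : algebra_grading G.
Variable pi : int -> {linear A -> A}.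
Hypothesis piP : graded_projection G pi.
Implicit Types (H : seq (int * A)) (w : seq (int * A)).

(* A letter is a pair (degree, homogeneous element). *)
Definition word_deg w : int := \sum_(h <- w) h.1.
Definition word_val w : A := \prod_(h <- w) h.2.
Definition words H (m : int) : set A :=
  [set a | exists w, [/\ {subset w <= H}, word_deg w = m & a = word_val w]].

Lemma words_finite H n : exists l : seq (seq (int * A)),
  forall w, {subset w <= H} -> (size w <= n)%N -> w \in l.
Proof.
elim: n => [|n [l lP]].
  by exists [:: [::]] => w _; rewrite leqn0 size_eq0 inE.
exists ([::] :: [seq h :: w | h <- H, w <- l]) => -[//|h w] hw wn.
rewrite inE; apply/orP; right; apply/allpairsP; exists (h, w); split=> //=.
  by apply: hw; rewrite mem_head.
by apply: lP => // x xw; apply: hw; rewrite inE xw orbT.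
Qed.

Lemma word_grading H w : (forall h, h \in H -> G h.1 h.2) ->
  {subset w <= H} -> G (word_deg w) (word_val w).
Proof.
move=> HG; elim: w => [|h w IHw] wH; rewrite /word_deg /word_val.
  by rewrite !big_nil; exact: (grading1 gradedA).
rewrite !big_cons; apply: (gradingM gradedA).
  by apply: HG; apply: wH; rewrite mem_head.
by apply: IHw => x xw; apply: wH; rewrite inE xw orbT.
Qed.

(** Every letter contributes at least 1 to [e] times the degree. The sign [e] is 1 for [Ap] and -1
    for [Am]. *)
Lemma word_deg_size (e : int) H w : (forall h, h \in H -> 0 < e * h.1) ->
  {subset w <= H} -> (size w)%:Z <= e * word_deg w.
Proof.
move=> He; elim: w => [|h w IHw] wH; first by rewrite /word_deg big_nil mulr0.
rewrite /word_deg big_cons mulrDr /=.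
have h0 : 0 < e * h.1 by apply: He; apply: wH; rewrite mem_head.
have : (size w)%:Z <= e * word_deg w.
  by apply: IHw => x xw; apply: wH; rewrite inE xw orbT.
rewrite /word_deg; move: (e * _) (e * _) h0 => x y; lia.
Qed.

Lemma graded_subalgebra_proj B m a : graded_subalgebra G B -> B a -> B (pi m a).
Proof.
case: piP => _ pi_hom _ [[B1 BL _] BE].
have hB : submod_closed [in B].
  split=> //; have := BL (- 1) 1 1 B1 B1; by rewrite scaleN1r addNr.
rewrite {1}BE => -[s [f [sf ->]]]; rewrite linear_sum.
apply: submod_sum_in => // k ks; have [_ [Bf Gf]] := sf k ks.
by rewrite (pi_hom _ _ _ Gf); case: ifP => // _; exact: submod0.
Qed.

(** The homogeneous components of the generators generate; those of the wrong sign vanish and those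
    of degree 0 are scalars, so all letters can be taken with [e] times their degree positive. *)
Lemma homogeneous_generators (e : int) B :
  graded_subalgebra G B -> finitely_generated_algebra B ->
  (forall m : int, e * m < 0 -> component G B m = [set 0]) ->
  (forall m : int, e * m = 0 -> m = 0) ->
  component G B 0 = range (fun c : K => c%:A) ->
  exists H, (forall h, h \in H -> [/\ 0 < e * h.1, B h.2 & G h.1 h.2]) /\
    forall m a, B a -> G m a -> lin_span (words H m) a.
Proof.
case: (piP) => piG pi_hom pi_sum gB [s sB] Bneg e0 B0.
have [S SP] : exists S : seq int, forall g k, g \in s -> pi k g != 0 -> k \in S.
  elim: s {sB} => [|g s [S SP]]; first by exists [::].
  have [S' gE] := pi_sum g; exists (S' ++ S) => h k.
  rewrite inE mem_cat => /orP[/eqP->|hs] hk; last by rewrite (SP h) ?orbT.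
  apply/orP; left; apply: contraNT hk => kS'.
  rewrite gE linear_sum big_seq big1 // => l lS'.
  rewrite (pi_hom _ l) //; case: eqP => // kl.
  by move: kS'; rewrite kl lS'.
have sB' g : g \in s -> B g.
  by rewrite sB => gs; apply: sub_gen_smallest.
pose H := [seq (k, pi k g) | g <- s, k <- [seq k <- S | 0 < e * k]].
have HP h : h \in H -> [/\ 0 < e * h.1, B h.2 & G h.1 h.2].
  move=> /allpairsP[[g k] /= [gs]]; rewrite mem_filter => /andP[ek _] ->.
  by split=> //=; exact: graded_subalgebra_proj gB (sB' _ gs).
exists H; split=> // m a Ba Ga.
(* The span condition is imposed on all components at once, which makes [T] a subalgebra; it then
   suffices to treat the generators. *)
pose T := [set a | forall m, lin_span (words H m) (pi m a)].
have hW m' : submod_closed [in lin_span (words H m')] by exact: lin_span_submod.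
have hT : submod_closed [in T].
  apply/submodP; split=> [k|c u v Tu Tv k].
    by rewrite linear0; exact: submod0.
  by rewrite linearP; exact: (submodL (hW k) _ (Tu k) (Tv k)).
suff : B `<=` T by move=> /(_ _ Ba m); rewrite (pi_hom _ _ _ Ga) eqxx.
have Thom k x : G k x -> lin_span (words H k) x -> T x.
  move=> Gx Wx l; rewrite (pi_hom _ _ _ Gx).
  by case: eqP => [->//|_]; exact: submod0.
have T1 : T 1.
  apply: (Thom 0); first exact: grading1.
  apply: lin_span_gen; exists [::]; split=> //.
    by rewrite /word_deg big_nil.
  by rewrite /word_val big_nil.
rewrite {1}sB; apply: smallest_sub => [|g gs k].
  split; first exact: mem_set.
    by move=> c u v; rewrite !inE; exact: submodL.
  move=> u v; rewrite !inE => Tu Tv.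
  have [su ->] := pi_sum u; have [sv ->] := pi_sum v.
  rewrite mulr_suml; apply: submod_sum => // i _.
  rewrite mulr_sumr; apply: submod_sum => // j _.
  apply: (Thom (i + j)); first exact: gradingM.
  move: (Tu i) (Tv j); apply: lin_span_mul => // x y [w [wH wi ->]] [w' [wH' wj ->]].
  apply: lin_span_gen; exists (w ++ w'); split.
  - by move=> h; rewrite mem_cat => /orP[/wH|/wH'].
  - by rewrite /word_deg big_cat /= -wi -wj.
  - by rewrite /word_val big_cat.
have Bg : component G B k (pi k g).
  by split=> //=; exact: graded_subalgebra_proj gB (sB' _ gs).
have [g0|g0] := eqVneq (pi k g) 0; first by rewrite g0; exact: submod0.
case: (ltgtP (e * k) 0) => ek.
- by move: Bg g0; rewrite Bneg // => ->; rewrite eqxx.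
- apply: lin_span_gen; exists [:: (k, pi k g)]; split.
  + move=> h; rewrite inE => /eqP ->; apply/allpairsP; exists (g, k).
    by split=> //=; rewrite mem_filter ek (SP g).
  + by rewrite /word_deg big_seq1.
  + by rewrite /word_val big_seq1.
- move: Bg; rewrite (e0 _ ek) B0 => -[c _ <-]; apply: (submodZ (hW 0)).
  apply: lin_span_gen; exists [::]; split=> //.
    by rewrite /word_deg big_nil.
  by rewrite /word_val big_nil.
Qed.

(** * The triangular decomposition and its finiteness consequences *)

Section Triangular.
Variables (Ap Am : set A) (Hp Hm : seq (int * A)).
Hypothesis gAp : graded_subalgebra G Ap.
Hypothesis gAm : graded_subalgebra G Am.
Hypothesis T0 : finitely_generated_bimodule Ap Am.
Hypothesis HpP : forall h, h \in Hp -> [/\ 0 < 1 * h.1, Ap h.2 & G h.1 h.2].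
Hypothesis HmP : forall h, h \in Hm -> [/\ 0 < -1 * h.1, Am h.2 & G h.1 h.2].
Hypothesis Hp_span : forall m a, Ap a -> G m a -> lin_span (words Hp m) a.
Hypothesis Hm_span : forall m a, Am a -> G m a -> lin_span (words Hm m) a.

Definition triples (E : seq (int * A)) (m : int) : set A :=
  [set a | exists w g w', [/\ {subset w <= Hp}, g \in E, {subset w' <= Hm},
    word_deg w + g.1 + word_deg w' = m & a = word_val w * g.2 * word_val w']].

(** The bimodule generators are replaced by their homogeneous components, which form the finite list
    [E]; an element [u g v] then splits by degree into triples. *)
Lemma triples_span : exists E, forall m a, G m a -> lin_span (triples E m) a.
Proof.
case: (piP) => piG pi_hom pi_sum; have [n [g gP]] := T0.
have [S SP] := choice (fun j => pi_sum (g j)).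
pose E := flatten [seq [seq (k, pi k (g j)) | k <- S j] | j <- enum 'I_n].
have EP j k : k \in S j -> (k, pi k (g j)) \in E.
  move=> kS; apply/flattenP; exists [seq (k, pi k (g j)) | k <- S j].
    by apply/mapP; exists j; rewrite ?mem_enum.
  by apply/mapP; exists k.
have EG h : h \in E -> G h.1 h.2.
  by move=> /flattenP[_ /mapP[j _ ->] /mapP[k _ ->]]; exact: piG.
exists E => m a Ga.
pose T := [set a | forall m, lin_span (triples E m) (pi m a)].
have hW m' : submod_closed [in lin_span (triples E m')] by exact: lin_span_submod.
have hT : submod_closed [in T].
  apply/submodP; split=> [k|c u v Tu Tv k].
    by rewrite linear0; exact: submod0.
  by rewrite linearP; exact: (submodL (hW k) _ (Tu k) (Tv k)).
suff : T a by move=> /(_ m); rewrite (pi_hom _ _ _ Ga) eqxx.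
have [t [tP ->]] := gP a.
apply: submod_sum => // j _; apply: submod_sum_in => // -[u v] /tP[/= Au Av].
have [su uE] := pi_sum u; have [sv vE] := pi_sum v.
rewrite uE vE (SP j) !mulr_suml; apply: submod_sum => // i _.
rewrite mulr_sumr; apply: submod_sum => // l _.
rewrite mulr_sumr mulr_suml; apply: submod_sum_in => // k kS m'.
have Gp : G (i + k + l) (pi i u * pi k (g j) * pi l v).
  by do 2 apply: gradingM => //.
rewrite (pi_hom _ _ _ Gp); case: eqP => [->|_]; last exact: submod0.
have := Hm_span (graded_subalgebra_proj l gAm Av) (piG l v).
have := Hp_span (graded_subalgebra_proj i gAp Au) (piG i u).
move=> ui vl; pose X := [set a | exists2 w, {subset w <= Hp} /\ word_deg w = i &
  a = word_val w * pi k (g j)].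
have Xu : lin_span X (pi i u * pi k (g j)).
  suff : lin_span (words Hp i) `<=` [set a | lin_span X (a * pi k (g j))] by exact.
  apply: lin_span_sub => [|_ [w [wH wi ->]]].
    apply/submodP; split=> [|c x y Xx Xy] /=.
      by rewrite mul0r; exact: submod0 (lin_span_submod X).
    by rewrite mulrDl -scalerAl; exact: (submodL (lin_span_submod X) _ Xx Xy).
  by apply: lin_span_gen; exists w.
move: Xu vl; apply: lin_span_mul => // x y [w [wH wi] ->] [w' [wH' wl ->]].
apply: lin_span_gen; exists w, (k, pi k (g j)), w'; split=> //.
- exact: EP.
- by rewrite wi wl.
Qed.

(** In a triple [w g w'], a word [w'] of more than [N] letters has degree below [-N] and sends the
    whole triple into the left ideal; otherwise [w'] ranges over a finite list, and the fixed total
    degree bounds [w]. [F] is chosen before [L], hence uniformly in modules. *)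
Lemma component_finite_mod (N : nat) m : exists F : seq A,
  forall L : set A, submod_closed [in L] -> (forall a b, L b -> L (a * b)) ->
  (forall k a, k <= - N%:Z -> G k a -> L a) ->
  forall a, G m a -> exists2 b, lin_span [set` F] b & L (a - b).
Proof.
have [E EP] := triples_span; have [l' lP'] := words_finite Hm N.
(* [b] bounds the degree left for [w], and so its length. *)
pose b := (\max_(p <- [seq (g, w') | g <- E, w' <- l'])
  absz (m - p.1.1 - word_deg p.2)%R)%N.
have [l lP] := words_finite Hp b.
pose F := [seq x * word_val w' | x <- [seq word_val w * g.2 | w <- l, g <- E],
  w' <- l'].
exists F => L hL LM LN a /EP.
pose T := [set a | exists2 b, lin_span [set` F] b & L (a - b)].
suff : lin_span (triples E m) `<=` T by move=> /[apply].
have hF := lin_span_submod [set` F].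
apply: lin_span_sub => [|_ [w [g [w' [wH gE wH' wm ->]]]]].
  apply/submodP; split=> [|c u v [u' Fu Lu] [v' Fv Lv]].
    by exists 0; rewrite ?subrr; exact: submod0.
  exists (c *: u' + v'); first exact: (submodL hF _ Fu Fv).
  by rewrite opprD addrACA -scalerBr; exact: (submodL hL _ Lu Lv).
have dw' := word_deg_size (fun h hH => let: And3 h0 _ _ := HmP hH in h0) wH'.
have dw := word_deg_size (fun h hH => let: And3 h0 _ _ := HpP hH in h0) wH.
have [sN|sN] := leqP (size w') N; last first.
  exists 0; first exact: submod0.
  rewrite subr0; apply: LM; apply: (LN (word_deg w')); first by lia.
  by apply: (word_grading (H := Hm)) => // h /HmP[].
have w'l := lP' _ wH' sN.
exists (word_val w * g.2 * word_val w'); last by rewrite subrr; exact: submod0.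
apply: lin_span_gen; apply/allpairsP; exists (word_val w * g.2, w'); split=> //=.
apply/allpairsP; exists (w, g); split=> //=; apply: lP => //.
have : (absz (m - g.1 - word_deg w')%R <= b)%N.
  apply: (@leq_bigmax_seq _ [seq (g, w') | g <- E, w' <- l'] xpredT
    (fun p => absz (m - p.1.1 - word_deg p.2)%R) (g, w')) => //.
  by apply/allpairsP; exists (g, w').
by move: dw wm; move: (word_deg w) (word_deg w') => x y; lia.
Qed.

(** In a triple [w g w'], a word [w'] with at least [n] letters kills [x]; the finitely many shorter
    ones leave the total degree bounded below, because [w] has nonnegative degree. *)
Lemma nilpotent_bounded (M : lmodType A) (x : M) n :
  (forall a : 'I_n -> A, (forall j, augmentation_minus G Am (a j)) ->
    (\prod_(j < n) a j) *: x = 0) ->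
  exists N : nat, forall m, m <= - N%:Z -> forall a, G m a -> a *: x = 0.
Proof.
move=> xn; have [E EP] := triples_span; have [l lP] := words_finite Hm n.
pose b := (\max_(p <- [seq (g, w') | g <- E, w' <- l])
  absz (p.1.1 + word_deg p.2)%R)%N.
exists b.+1 => m mb a /EP.
suff : lin_span (triples E m) `<=` [set a | a *: x = 0] by move=> /[apply].
apply: lin_span_sub => [|_ [w [g [w' [wH gE wH' wm ->]]]]].
  apply/submodP; split=> [|c u v /= ux vx]; first by rewrite /= scale0r.
  rewrite /= scalerDl vx addr0 -[u]mul1r scalerAl -scalerA ux scaler0 //.
have dw := word_deg_size (fun h hH => let: And3 h0 _ _ := HpP hH in h0) wH.
have [sn|sn] := leqP n (size w'); last first.
  have w'l := lP _ wH' (ltnW sn).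
  have : (absz (g.1 + word_deg w')%R <= b)%N.
    apply: (@leq_bigmax_seq _ [seq (g, w') | g <- E, w' <- l] xpredT
      (fun p => absz (p.1.1 + word_deg p.2)%R) (g, w')) => //.
    by apply/allpairsP; exists (g, w').
  by move: dw wm mb; move: (word_deg w) (word_deg w') => y z; lia.
rewrite /= -scalerA; suff -> : word_val w' *: x = 0 by rewrite scaler0.
(* The last [n] letters act first on [x]; the first [k] are split off on the left. *)
pose k := (size w' - n)%N.
have -> : word_val w' = word_val (take k w') * word_val (drop k w').
  by rewrite /word_val -big_cat cat_take_drop.
rewrite -scalerA /word_val [X in _ *: (X *: _)](big_nth (0, 0)) size_drop subKn //.
rewrite big_mkord xn ?scaler0 // => j.
set h := nth _ _ _; have hH : h \in Hm.
  by apply/wH'/(mem_drop (n0 := k))/mem_nth; rewrite size_drop subKn.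
have [h0 Ah Gh] := HmP hH.
exists [fset - h.1]%fset, (fun=> h.2); rewrite big_seq_fset1; split=> // q.
rewrite inE => /eqP ->; rewrite opprK; split=> //.
by move: h0; rewrite mulN1r.
Qed.

End Triangular.

(** A product of [n] elements of the augmentation ideal lives in degrees at most [-n]. The successor
    keeps the number of factors positive, as [locally_nilpotent] demands. *)
Lemma bounded_nilpotent Am (M : lmodType A) (x : M) (N : nat) :
  (forall m, m <= - N%:Z -> forall a, G m a -> a *: x = 0) ->
  forall a : 'I_N.+1 -> A, (forall j, augmentation_minus G Am (a j)) ->
    (\prod_(j < N.+1) a j) *: x = 0.
Proof.
case: (piP) => piG pi_hom pi_sum xN a aA.
pose D (n : nat) := [set b | forall m, - n%:Z < m -> pi m b = 0].
have D0 n : D n 0 by move=> m _; rewrite linear0.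
have DD n u v : D n u -> D n v -> D n (u + v).
  by move=> Du Dv m nm; rewrite linearD Du // Dv // addr0.
have Dhom n k b : k <= - n%:Z -> G k b -> D n b.
  by move=> kn Gb m nm; rewrite (pi_hom _ _ _ Gb); case: eqP => // mk; lia.
have DM i j u v : D i u -> D j v -> D (i + j)%N (u * v).
  move=> Du Dv; have [su ->] := pi_sum u; have [sv ->] := pi_sum v.
  rewrite mulr_suml; apply: (big_ind (D _)) => [||k _]; [exact: D0| |]; first exact: DD.
  rewrite mulr_sumr; apply: (big_ind (D _)) => [||l _]; [exact: D0| |]; first exact: DD.
  case: (ltP (- i%:Z) k) => ik; first by rewrite Du // mul0r.
  case: (ltP (- j%:Z) l) => jl; first by rewrite Dv // mulr0.
  by apply: (Dhom _ (k + l)); [lia|exact: gradingM].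
have DA b : augmentation_minus G Am b -> D 1%N b.
  move=> [s [f [sf ->]]]; rewrite big_seq.
  apply: (big_ind (D _)) => [||k ks]; first exact: D0.
    exact: DD.
  by have [k0 [_ Gf]] := sf k ks; apply: (Dhom _ (- k)) => //; lia.
have Dprod n (c : 'I_n -> A) : (forall j, D 1%N (c j)) -> D n (\prod_(j < n) c j).
  elim: n c => [|n IHn] c cD.
    by rewrite big_ord0; apply: (Dhom _ 0) => //; exact: grading1.
  by rewrite big_ord_recl; apply: (DM 1%N n) => //; apply: IHn.
have := Dprod _ a (fun j => DA _ (aA j)); move: (\prod_(j < _) _) => b Db.
have [s ->] := pi_sum b; rewrite scaler_suml big1 // => k _.
case: (ltP (- N.+1%:Z) k) => Nk; first by rewrite Db // scale0r.
by apply: (xN k) => //; lia.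
Qed.

End Words.

(** * Polynomials in the inner grading element *)

Section Polynomials.
Variable K : numClosedFieldType.
Implicit Types p q : {poly K}.

Definition shift_poly (m : int) p := p \Po ('X + (m%:~R)%:P).

Lemma avoid_integers (s : seq K) :
  exists N : nat, forall m : int, (N <= absz m)%N -> m%:~R \notin s.
Proof.
elim: s => [|z s [N NP]]; first by exists 0%N.
have [[m0 m0z]|no] := pselect (exists m0 : int, m0%:~R = z).
  exists (maxn N (absz m0).+1) => m; rewrite geq_max => /andP[Nm m0m].
  rewrite inE negb_or NP // andbT -m0z eqr_int.
  by apply: contraTneq m0m => ->; rewrite ltnn.
exists N => m Nm; rewrite inE negb_or NP // andbT.
by apply/eqP => mz; apply: no; exists m.
Qed.

(** A common root of [p] and of [q] shifted by [m] exhibits [m] as a difference of a root of [q] and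
    a root of [p]; only finitely many integers are such differences. *)
Lemma coprimep_shift p q : p != 0 -> q != 0 ->
  exists N : nat, forall m : int, (N <= absz m)%N -> coprimep p (shift_poly m q).
Proof.
move=> p0 q0; have [rp pE] := closed_field_poly_normal p.
have [rq qE] := closed_field_poly_normal q.
have rootE (r : {poly K}) (rs : seq K) : r != 0 ->
    r = lead_coef r *: \prod_(z <- rs) ('X - z%:P) -> root r =i rs.
  by move=> r0 -> x; rewrite [LHS]rootZ ?lead_coef_eq0 // root_prod_XsubC.
have [N NP] := avoid_integers [seq w - z | w <- rq, z <- rp].
exists N => m /NP; apply: contraNT; rewrite /coprimep => /closed_rootP[x].
rewrite root_gcd => /andP[px]; rewrite /shift_poly root_comp !hornerE => qx.
apply/allpairsP; exists (x + m%:~R, x) => /=; split.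
- by rewrite -(rootE q).
- by rewrite -(rootE p).
- by rewrite addrC addKr.
Qed.

(** The ideals generated by the powers of [q] modulo [g] stabilize: the degree of the gcd of
    [q ^+ k] and [g] is bounded by that of [g], and where it is largest the next gcd divides
    [q ^+ k]. *)
Lemma power_stabilizes q g : g != 0 ->
  exists k u v, q ^+ k = u * q ^+ k.+1 + v * g.
Proof.
move=> g0; pose P n := `[< exists k, size (gcdp (q ^+ k) g) = n >].
have P1 : exists n, P n by exists (size (gcdp (q ^+ 0) g)); apply/asboolP; exists 0%N.
have Pub n : P n -> (n <= size g)%N.
  by move=> /asboolP[k <-]; exact: leq_gcdpr.
case: (ex_maxnP P1 Pub) => n /asboolP[k kn] nmax.
have dvd : gcdp (q ^+ k) g %| gcdp (q ^+ k.+1) g.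
  by rewrite dvdp_gcd dvdp_gcdr exprS (dvdp_trans (dvdp_gcdl _ _)) // dvdp_mulIr.
have le : (size (gcdp (q ^+ k.+1) g) <= size (gcdp (q ^+ k) g))%N.
  by rewrite kn; apply: nmax; apply/asboolP; exists k.+1.
have eqg : gcdp (q ^+ k) g %= gcdp (q ^+ k.+1) g.
  have gn0 : gcdp (q ^+ k.+1) g != 0 by rewrite gcdp_eq0 negb_and g0 orbT.
  by rewrite -dvdp_size_eqp // eqn_leq le andbT dvdp_leq.
have [[u v] /= uv] := Bezoutp (q ^+ k.+1) g.
have : u * q ^+ k.+1 + v * g %| q ^+ k.
  by rewrite (eqp_dvdl _ uv) -(eqp_dvdl _ eqg) dvdp_gcdl.
by move=> /dvdpP[w qk]; exists k, (w * u), (w * v); rewrite qk mulrDr !mulrA.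
Qed.

End Polynomials.

(** * Polynomials in [delta] acting on modules *)

Section InnerGrading.
Variables (K : numClosedFieldType) (A : algType K) (G : int -> set A).
Variable delta : A.
Hypothesis gradedA : algebra_grading G.
Hypothesis innerA : inner_grading G delta.

(** The model is the annihilator of a vector killed in all degrees at most [-N]. Quantifying over
    all such ideals makes the resulting constants independent of the module. *)
Definition left_ideal_above (N : nat) (L : set A) : Prop :=
  [/\ submod_closed [in L], forall a b, L b -> L (a * b)
    & forall k a, k <= - N%:Z -> G k a -> L a].

Hypothesis component_fin : forall (N : nat) (m : int), exists F : seq A,
  forall L, left_ideal_above N L -> forall a, G m a ->
  exists2 b, lin_span [set` F] b & L (a - b).

Local Notation ev p := (horner_alg delta p).

(** The commutator of [delta] with itself is 0, but it is also the sum of [k] times the degree [k]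
    component of [delta]; in characteristic 0 only degree 0 survives. *)
Lemma delta_degree0 : G 0 delta.
Proof.
have [pi piP] := graded_projection_exists gradedA; case: (piP) => piG pi_hom pi_sum.
have [s sE] := pi_sum delta.
have pi0 m : m != 0 -> pi m delta = 0.
  move=> m0; have : pi m (\sum_(k <- s) pi k delta *~ k) = 0.
    rewrite -[RHS](linear0 (pi m)); congr (pi m _).
    under eq_bigr => k _ do rewrite -(innerA (piG k delta)).
    by rewrite sumrB -mulr_sumr -mulr_suml -sE subrr.
  have -> : \sum_(k <- s) pi k delta *~ k = \sum_(k <- s) (k%:~R : K) *: pi k delta.
    by apply: eq_bigr => k _; rewrite scaler_int.
  rewrite linear_sum /= => e.
  have : (m%:~R : K) *: pi m (\sum_(k <- s) pi k delta) = 0.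
    rewrite -[RHS]e linear_sum scaler_sumr; apply: eq_bigr => k _.
    rewrite linearZ /= (pi_hom _ _ _ (piG k delta)).
    by case: eqP => [->//|_]; rewrite !scaler0.
  by rewrite -sE => /eqP; rewrite scaler_eq0 intr_eq0 (negPf m0) => /eqP.
rewrite sE; apply: (submod_sum (grading_submod gradedA 0)) => k _.
have [->|k0] := eqVneq k 0; first exact: piG.
by rewrite pi0 //; exact: submod0 (grading_submod gradedA 0).
Qed.

Lemma ev_degree0 p : G 0 (ev p).
Proof.
have h0 := grading_submod gradedA 0.
elim/poly_ind: p => [|p c IHp]; first by rewrite linear0; exact: submod0.
rewrite rmorphD rmorphM /= horner_algX horner_algC; apply: (submodD h0).
  by rewrite -[0]addr0; apply: (gradingM gradedA) => //; exact: delta_degree0.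
by apply: (submodZ h0); exact: grading1.
Qed.

Lemma ev_comm p q : ev p * ev q = ev q * ev p.
Proof. by rewrite -!rmorphM mulrC. Qed.

Lemma scalar_comm (a : A) (c : K) : a * c%:A = c%:A * a.
Proof. by rewrite -scalerAr -scalerAl mulr1 mul1r. Qed.

Lemma mul_ev m a p : G m a -> a * ev p = ev (shift_poly (- m) p) * a.
Proof.
move=> Ga; elim/poly_ind: p => [|p c IHp].
  by rewrite /shift_poly comp_poly0 !linear0 mulr0 mul0r.
have dE : a * delta = ev ('X + ((- m)%:~R)%:P) * a.
  rewrite rmorphD /= horner_algX horner_algC mulrDl -scalerAl mul1r.
  have := innerA Ga; rewrite scaler_int mulrNz => <-.
  by rewrite opprB addrC subrK.
rewrite /shift_poly comp_polyD comp_polyM comp_polyX comp_polyC.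
rewrite !rmorphD !rmorphM /= mulrDr mulrDl horner_algX !horner_algC scalar_comm.
congr (_ + _); rewrite mulrA IHp -!mulrA; congr (_ * _); rewrite dE.
by rewrite rmorphD /= horner_algX horner_algC.
Qed.

Definition killed (N : nat) (M : lmodType A) (x : M) : Prop :=
  forall m, m <= - N%:Z -> forall a, G m a -> a *: x = 0.

(** The form in which local nilpotence of the negative part is used; it mentions only the grading of
    [A]. *)
Definition bounded (M : lmodType A) : Prop := forall x : M, exists N, killed N x.

Lemma killed_leq N N' (M : lmodType A) (x : M) :
  (N <= N')%N -> killed N x -> killed N' x.
Proof. by move=> NN' xN m mN' a; apply: xN; lia. Qed.

(** Working relative to [Y] gives statements about the quotient by [Y] without forming it. *)
Lemma conductor_ideal N (M : lmodType A) (x : M) (Y : set M) :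
  submod_closed [in Y] ->
  (forall m, m <= - N%:Z -> forall a, G m a -> Y (a *: x)) ->
  left_ideal_above N [set a | Y (a *: x)].
Proof.
move=> hY xN; split=> [|a b /= Yb|k a kN Ga]; last exact: xN kN _ Ga.
- apply/submodP; split=> [|c a b /= Ya Yb].
    by rewrite /= scale0r; exact: submod0.
  rewrite /= scalerDl -[a]mul1r scalerAl -scalerA; exact: submodL.
- by rewrite /= -scalerA; exact: submodZ.
Qed.

Lemma killed_ideal N (M : lmodType A) (x : M) :
  killed N x -> left_ideal_above N [set a | a *: x = 0].
Proof. exact: conductor_ideal (submod_set0 M). Qed.

(** Powers of [delta] have degree 0, and degree 0 is finite dimensional modulo the smallest
    admissible left ideal [L0], so they are dependent modulo [L0]; the dependence holds modulo every
    larger ideal. *)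
Lemma annihilating_poly N : exists2 p : {poly K}, p != 0 &
  forall L, left_ideal_above N L -> L (ev p).
Proof.
pose L0 := [set a | forall L, left_ideal_above N L -> L a].
have gL0 : left_ideal_above N L0.
  split=> [|a b L0b L gL|k a kN Ga L [_ _ LN]]; last exact: LN kN Ga.
  - apply/submodP; split=> [L [hL _ _]|c a b La Lb L gL]; first exact: submod0.
    by case: (gL) => hL _ _; exact: (submodL hL _ (La _ gL) (Lb _ gL)).
  - by case: (gL) => _ LM _; apply: LM; exact: L0b.
have [F FP] := component_fin N 0; have [e eF] := lin_span_seq F.
have bP (i : 'I_(size F).+1) : exists c : 'rV[K]_(size F),
    L0 (ev 'X^i - lin_comb e c).
  by have [b /eF[c _ <-] Lb] := FP _ gL0 _ (ev_degree0 'X^i); exists c.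
have [c cP] := choice bP.
(* [C] has one more row than columns, so a nonzero row [v] kills it; its entries are the
   coefficients of the polynomial. *)
pose C := \matrix_i c i; pose v := nz_row (kermx C).
have v0 : v != 0.
  rewrite nz_row_eq0 -mxrank_eq0 mxrank_ker subn_eq0 -ltnNge ltnS.
  exact: rank_leq_col.
have vC : v *m C = 0 by apply/sub_kermxP; exact: nz_row_sub.
pose p := \poly_(i < (size F).+1) v 0 (inord i).
exists p.
  have [i vi] : exists i, v 0 i != 0.
    apply: contrapT => /forallNP no; move/negP: v0; apply; apply/eqP/rowP => i.
    by rewrite mxE; apply/eqP/negbNE/negP/no.
  apply: contraNneq vi => /(congr1 (fun r : {poly K} => r`_i)).
  by rewrite coef0 coef_poly ltn_ord inord_val => ->.
suff : L0 (ev p) by [].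
have [hL0 _ _] := gL0.
have -> : ev p = \sum_(i < (size F).+1) v 0 i *: (ev 'X^i - lin_comb e (c i)).
  under [RHS]eq_bigr do rewrite scalerBr.
  rewrite sumrB; have -> : \sum_i v 0 i *: lin_comb e (c i) = lin_comb e (v *m C).
    rewrite mulmx_sum_row linear_sum; apply: eq_bigr => i _.
    by rewrite linearZ /= rowK.
  rewrite vC linear0 subr0 /p poly_def linear_sum; apply: eq_bigr => i _.
  by rewrite linearZ /= inord_val -scalerAl mul1r.
by apply: (submod_sum hL0) => i _; exact: (submodZ hL0).
Qed.

(** Among the degrees [-n] in which some [a] keeps [a *: x] outside [Y], which are bounded because
    [x] is killed far down, the lowest one is taken. *)
Lemma lowest_vector (M : lmodType A) (Y : set M) (x : M) :
  bounded M -> submod_closed [in Y] -> ~ Y x ->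
  exists (n : nat) (a : A), [/\ G (- n%:Z) a, ~ Y (a *: x) &
    forall k b, k <= - 1%:Z -> G k b -> Y (b *: (a *: x))].
Proof.
move=> bM hY Yx; have [N xN] := bM x.
pose P n := `[< exists a, G (- n%:Z) a /\ ~ Y (a *: x) >].
have P0 : exists n, P n.
  exists 0%N; apply/asboolP; exists 1; rewrite scale1r; split=> //.
  exact: grading1.
have Pub n : P n -> (n <= N)%N.
  move=> /asboolP[a [Ga Ya]]; rewrite leqNgt; apply/negP => Nn; apply: Ya.
  by rewrite (xN _ _ _ Ga); [exact: submod0|lia].
case: (ex_maxnP P0 Pub) => n /asboolP[a [Ga Ya]] nmax.
exists n, a; split=> // k b k1 Gb; apply: contrapT; rewrite scalerA => Yba.
have /nmax : P (n + absz k)%N.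
  apply/asboolP; exists (b * a); split=> //.
  have -> : - (n + absz k)%N%:Z = k + - n%:Z by lia.
  exact: gradingM.
by lia.
Qed.

Lemma coprimep_ev (M : lmodType A) (x : M) p q :
  coprimep p q -> ev p *: x = 0 -> ev q *: x = 0 -> x = 0.
Proof.
move=> /Bezout_eq1_coprimepP[[u v] /= uv] px qx.
have : ev (u * p + v * q) *: x = x by rewrite uv rmorph1 scale1r.
by rewrite rmorphD !rmorphM /= scalerDl -!scalerA px qx !scaler0 addr0.
Qed.

(* The roots of the minimal polynomial of [delta] on the vectors killed by all
   negative components are the only possible lowest weights; [q] is a power of
   that polynomial, so that the kernel of [q] collects the generalized
   eigenspaces for these weights, uniformly in the module. *)
Lemma weight_poly_exists : exists (q : {poly K}) (N0 : nat), q != 0 /\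
  forall M : lmodType A, bounded M ->
  [/\ forall x : M, ev q *: x = 0 -> killed N0 x,
      forall (x : M) j, ev (q ^+ j) *: x = 0 -> ev q *: x = 0,
      forall x : M, exists s, ev q *: x = ev (q * q * s) *: x
    & forall (Y : set M) (x : M), submod_closed [in Y] -> ~ Y x ->
        exists a, ~ Y (a *: x) /\ Y (ev q *: (a *: x))].
Proof.
have [p p0 pP] := annihilating_poly 1.
have [N0 N0P] := coprimep_shift p0 p0.
(* If [a] of degree at most [-N0] did not kill [x], a lowest vector below [a *: x] would be killed
   both by [p] and by a shift of [p ^+ j] by at least [N0], which are coprime. *)
have killedN0 (M : lmodType A) (x : M) j : bounded M ->
    ev (p ^+ j) *: x = 0 -> killed N0 x.
  move=> bM px m mN0 a Ga; apply: contrapT => ax0.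
  have [n [b [Gb bax blow]]] := lowest_vector bM (submod_set0 M) ax0.
  have pz : ev p *: (b *: (a *: x)) = 0.
    exact: pP (conductor_ideal (submod_set0 M) (fun k kN c Gc => blow k c kN Gc)).
  apply: bax; apply: (@coprimep_ev _ _ p (shift_poly (- (- n%:Z + m)) (p ^+ j))) => //.
    rewrite /shift_poly rmorphXn coprimep_expr //; apply: N0P; lia.
  rewrite (scalerA b) scalerA -(mul_ev _ (gradingM gradedA Gb Ga)) -scalerA px.
  by rewrite scaler0.
have [g g0 gP] := annihilating_poly N0.
have [k0 [u [v uvE]]] := power_stabilizes p g0.
(* [g] kills every such [x], so [p ^+ j] with [j >= k0] acts on [x] as a multiple of [p ^+ j.+1];
   descending from a vanishing power reaches [k0], which does not depend on [M]. *)
have stab (M : lmodType A) (x : M) j : bounded M ->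
    ev (p ^+ j) *: x = 0 -> ev (p ^+ k0) *: x = 0.
  move=> bM; elim: j => [|j IHj] px.
    by move: px; rewrite expr0 rmorph1 scale1r => ->; rewrite scaler0.
  have [jk|kj] := ltnP j k0.
    by rewrite -(subnK jk) exprD rmorphM /= -scalerA px scaler0.
  apply: IHj; rewrite -(subnKC kj) exprD uvE mulrDl rmorphD scalerDl.
  have gx : ev g *: x = 0 by exact: gP (killed_ideal (killedN0 _ _ _ bM px)).
  rewrite -!mulrA -exprD addSn subnKC // rmorphM /= -scalerA px scaler0 add0r.
  by rewrite [g * _]mulrC mulrA rmorphM /= -scalerA gx scaler0.
(* The exponent [k0.+1] makes [q] a multiple of [p] even when [k0] is 0; the last clause relies on
   this. *)
pose q := p ^+ k0.+1; have q0 : q != 0 by rewrite expf_neq0.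
exists q, N0; split=> // M bM; split=> [x|x j|x|Y x hY Yx].
- exact: killedN0.
- rewrite -exprM => /(stab _ _ _ bM); rewrite /q exprS rmorphM /= -scalerA => ->.
  by rewrite scaler0.
(* With [h] killing [x], stabilization gives that [q ^+ k] kills [(1 - q s) x]; by [stab] already
   [q] does. *)
- have [N xN] := bM x; have [h h0 hP] := annihilating_poly N.
  have hx : ev h *: x = 0 by exact: hP (killed_ideal xN).
  have [k [s [t stE]]] := power_stabilizes q h0; exists s.
  apply/eqP; rewrite -subr_eq0 -scalerBl -rmorphB.
  have -> : q - q * q * s = q * (1 - q * s) by rewrite mulrBr mulr1 mulrA.
  rewrite rmorphM /= -scalerA; apply/eqP.
  have : ev (q ^+ k) *: (ev (1 - q * s) *: x) = 0.
    rewrite scalerA -rmorphM mulrBr mulr1 {1}stE mulrA -exprSr [s * _]mulrC.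
    by rewrite addrAC subrr add0r rmorphM /= -scalerA hx scaler0.
  rewrite -exprM => /(stab _ _ _ bM) H.
  by rewrite {1}/q exprS rmorphM /= -scalerA H scaler0.
- have [n [a [Ga Ya alow]]] := lowest_vector bM hY Yx; exists a; split=> //.
  have := pP _ (conductor_ideal hY (fun k kN c Gc => alow k c kN Gc)).
  by rewrite /= /q exprSr rmorphM /= -[(_ * ev p) *: _]scalerA; exact: submodZ.
Qed.

End InnerGrading.

(** * Bounded modules *)

Section BoundedModules.
Variables (K : numClosedFieldType) (A : algType K) (G : int -> set A).
Variable delta : A.
Hypothesis gradedA : algebra_grading G.
Hypothesis innerA : inner_grading G delta.
Hypothesis component_fin : forall (N : nat) (m : int), exists F : seq A,
  forall L, left_ideal_above G N L -> forall a, G m a ->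
  exists2 b, lin_span [set` F] b & L (a - b).
Local Notation ev p := (horner_alg delta p).
Local Notation bounded := (@bounded K A G).
Local Notation killed := (@killed K A G).

Lemma ev_scaleC (M : lmodType A) p r (x : M) :
  ev p *: (ev r *: x) = ev r *: (ev p *: x).
Proof. by rewrite !scalerA ev_comm. Qed.

Lemma ev_kernel_submod (M : lmodType A) p :
  submod_closed [in ([set x : M | ev p *: x = 0] : set (Kmodule M))].
Proof.
apply/submodP; split=> [|c x y /= px py]; first by rewrite /= scaler0.
rewrite /= scalerDr py addr0 Kmodule_scaleE scalerA scalar_comm -scalerA.
by rewrite px scaler0.
Qed.

Definition fg_bounded (M : lmodType A) : Prop :=
  finitely_generated_module M /\ bounded M.

Lemma common_killed (M : lmodType A) n (e : 'I_n -> M) : bounded M ->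
  exists N, forall j, killed N (e j).
Proof.
move=> bM; have [f fP] := choice (fun j => bM (e j)).
exists (\max_j f j)%N => j; apply: killed_leq (fP j).
exact: (leq_bigmax_cond (F := f)).
Qed.

Lemma lin_span_image (V W : lmodType K) (f : {linear V -> W}) (X : set V) x :
  lin_span X x -> lin_span (f @` X) (f x).
Proof.
move=> Xx; suff : lin_span X `<=` f @^-1` lin_span (f @` X) by apply.
apply: lin_span_sub => [|y Xy]; first exact/submod_preimage/lin_span_submod.
by apply: lin_span_gen; exists y.
Qed.

Lemma component_act_finite (M : lmodType A) (x : M) N m : killed N x ->
  exists F : seq A, forall a, G m a ->
    lin_span (act x @` [set` F]) (act x a).
Proof.
move=> xN; have [F FP] := component_fin N m; exists F => a Ga.
have [b Fb ab] := FP _ (killed_ideal xN) a Ga.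
have -> : act x a = act x b by apply/eqP; rewrite -subr_eq0 -linearB; apply/eqP.
exact: lin_span_image.
Qed.

Lemma mem_range_int (N : nat) (m : int) : (absz m < N)%N ->
  m \in [seq k%:Z | k <- iota 0 N] ++ [seq - k%:Z | k <- iota 0 N].
Proof.
move=> mN; rewrite mem_cat; apply/orP; have [m0|m0] := leP 0 m; [left|right].
  by apply/mapP; exists (absz m); rewrite ?mem_iota //; lia.
by apply/mapP; exists (absz m); rewrite ?mem_iota //; lia.
Qed.

(** [M] is the sum of the pieces [A(m) e_j]. Those with small [m] span a finite-dimensional
    [delta]-stable space [V]; on the others a polynomial coprime to [p] vanishes, and a Bezout
    relation pushes the generalized kernel into [V]. *)
Lemma generalized_kernel_finite (M : lmodType A) p : fg_bounded M -> p != 0 ->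
  exists n, rank_le ([set x : M | exists k, ev (p ^+ k) *: x = 0] :
    set (Kmodule M)) n.
Proof.
move=> [[r [e eP]] bM] p0; have [N eN] := common_killed e bM.
have [g g0 gP] := annihilating_poly gradedA innerA component_fin N.
have [N1 N1P] := coprimep_shift p0 g0.
pose S := [seq k%:Z | k <- iota 0 N1] ++ [seq - k%:Z | k <- iota 0 N1].
have Fex (p : 'I_r * int) := component_act_finite p.2 (eN p.1).
have [F FP] := choice Fex.
pose s : seq (Kmodule M) :=
  [seq act (e u.1) b | u <- [seq (j, m) | j <- enum 'I_r, m <- S], b <- F u].
pose V : set (Kmodule M) := lin_span
  [set y : Kmodule M | exists j m a, [/\ m \in S, G m a & y = act (e j) a]].
have hV : submod_closed [in V] by exact: lin_span_submod.
exists (size s); apply: rank_le_sub (lin_span_seq s).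
have Vs : V `<=` lin_span [set` s].
  apply: lin_span_sub => [|_ [j [m [a [mS Ga ->]]]]]; first exact: lin_span_submod.
  have := FP (j, m) a Ga; apply: lin_span_sub; first exact: lin_span_submod.
  move=> _ [b /= Fb <-]; apply: lin_span_gen.
  apply/allpairsPdep; exists (j, m), b; split=> //.
  by apply/allpairsP; exists (j, m); rewrite mem_enum.
apply: subset_trans Vs => x [k pk].
have Vev t y : V y -> V (ev t *: y).
  pose f : {linear Kmodule M -> Kmodule M} :=
    linear_of (@lact_linear _ _ M _ (scalar_comm (ev t))).
  suff : V `<=` f @^-1` V by apply.
  apply: lin_span_sub => [|_ [j [m [a [mS Ga ->]]]]]; first exact: submod_preimage.
  apply: lin_span_gen; exists j, m, (ev t * a); split=> //.
    by rewrite -[m]add0r; apply: gradingM => //; exact: (ev_degree0 gradedA innerA).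
  by rewrite /f linear_ofE scalerA.
pose W : set (Kmodule M) :=
  [set y : M | exists2 R, coprimep p R & ev R *: y = 0].
have hW : submod_closed [in W].
  apply/submodP; split=> [|c y z [R pR Ry] [R' pR' R'z]].
    by exists 1; rewrite ?coprimep1 ?scaler0.
  exists (R * R'); first by rewrite coprimepMr pR.
  rewrite scalerDr Kmodule_scaleE (scalerA _ c%:A) scalar_comm -scalerA.
  by rewrite {1}[R * R']mulrC !rmorphM /= -!scalerA Ry R'z !scaler0 addr0.
have [y [w [Vy [R pR Rw] xE]]] : exists y w, [/\ V y, W w & x = y + w].
  have [pi [piG _ pi_sum]] := graded_projection_exists gradedA.
  pose VW := [set x | exists y w, [/\ V y, W w & x = y + w]].
  have VWD a b : VW a -> VW b -> VW (a + b).
    move=> [y [w [Vy Ww ->]]] [y' [w' [Vy' Ww' ->]]].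
    exists (y + y'), (w + w'); rewrite addrACA; split=> //.
      exact: (submodD hV Vy Vy').
    exact: (submodD hW Ww Ww').
  have VW0 : VW 0.
    exists 0, 0; rewrite addr0; split=> //; [exact: submod0 hV|exact: submod0 hW].
  have [a ->] := eP x; apply: (big_ind VW) => // j _.
  have [sa ->] := pi_sum (a j); rewrite scaler_suml; apply: (big_ind VW) => // m _.
  have [mN|mN] := ltnP (absz m) N1.
    exists (pi m (a j) *: e j), 0; rewrite addr0; split=> //; last exact: submod0 hW.
    by apply: lin_span_gen; exists j, m, (pi m (a j)); split=> //; exact: mem_range_int.
  exists 0, (pi m (a j) *: e j); rewrite add0r; split=> //; first exact: submod0 hV.
  (* [g] kills [e j], so its shift kills [A(m) e_j]; it is coprime to [p] because [m] is far from
     0. *)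
  exists (shift_poly (- m) g); first by apply: N1P; rewrite abszN.
  have := gP _ (killed_ideal (eN j)) => /= ge.
  by rewrite scalerA -(mul_ev innerA _ (piG m (a j))) -scalerA ge scaler0.
have /Bezout_eq1_coprimepP[[u v] /= uv] : coprimep (p ^+ k) R by exact: coprimep_expl.
have -> : x = ev v *: (ev R *: y).
  have : ev (u * p ^+ k + v * R) *: x = x by rewrite uv rmorph1 scale1r.
  rewrite rmorphD !rmorphM /= scalerDl -!scalerA pk scaler0 add0r => <-.
  by rewrite xE [ev R *: (_ + _)]scalerDr Rw addr0.
exact: (Vev v _ (Vev R _ Vy)).
Qed.

(** The stable subspace through [x] is [A(0) x]: [delta] has degree 0, and [A(0)] is finite
    dimensional modulo the annihilator of [x]. *)
Lemma bounded_locally_finite (M : lmodType A) : bounded M -> locally_finite M delta.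
Proof.
move=> bM x; have [N xN] := bM x; have [F FP] := component_act_finite 0 xN.
pose S : set M := act x @` G 0.
have hS : submod_closed [in (S : set (Kmodule M))].
  exact: (submod_image (act x) (grading_submod gradedA 0)).
exists S; split=> [| |_ [a Ga <-]].
- apply: (finite_dimensionalP hS (n := size [seq act x b | b <- F])).
  apply: rank_le_sub (lin_span_seq _) => _ [a Ga <-].
  move: (FP a Ga); apply: lin_span_sub; first exact: lin_span_submod.
  by move=> _ [b Fb <-]; apply: lin_span_gen; exact: map_f.
- by exists 1; [exact: (grading1 gradedA)|rewrite actE scale1r].
- exists (delta * a); last by rewrite !actE scalerA.
  by rewrite -[0]addr0; apply: (gradingM gradedA) => //; exact: delta_degree0.
Qed.

Lemma generalized_eigenspace_finite (M : lmodType A) l : fg_bounded M ->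
  finite_dimensional (generalized_eigenspace M delta l).
Proof.
move=> oM; pose p : {poly K} := 'X - l%:P.
have evX n : ev (p ^+ n) = (delta - l%:A) ^+ n.
  by rewrite rmorphXn rmorphB /= horner_algX horner_algC.
have -> : generalized_eigenspace M delta l =
    [set x : M | exists k, ev (p ^+ k) *: x = 0].
  by apply/seteqP; split=> x [n xn]; exists n; move: xn; rewrite evX.
have [|n rn] := generalized_kernel_finite oM (p := p).
  by rewrite polyXsubC_eq0.
apply: finite_dimensionalP rn; apply/submodP; split=> [|c x y [i xi] [j yj]].
  by exists 0%N; rewrite scaler0.
exists (i + j)%N; rewrite exprD; apply: (submodL (ev_kernel_submod M _)) => /=.
  by rewrite mulrC rmorphM /= -scalerA xi scaler0.
by rewrite rmorphM /= -scalerA yj scaler0.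
Qed.

Variables (q : {poly K}) (N0 : nat).
Hypothesis q_neq0 : q != 0.

Local Notation T := (horner_alg delta q).

Hypothesis weight_poly : forall M : lmodType A, bounded M ->
  [/\ forall x : M, T *: x = 0 -> killed N0 x,
      forall (x : M) j, ev (q ^+ j) *: x = 0 -> T *: x = 0,
      forall x : M, exists s, T *: x = ev (q * q * s) *: x
    & forall (Y : set M) (x : M), submod_closed [in Y] -> ~ Y x ->
        exists a, ~ Y (a *: x) /\ Y (T *: (a *: x))].

(** * The kernel of [q(delta)]: splitting, faithfulness, finiteness *)

Definition weight_space (M : lmodType A) : set (Kmodule M) :=
  [set x : M | T *: x = 0].

Lemma weight_space_submod (M : lmodType A) : submod_closed [in @weight_space M].
Proof. exact: ev_kernel_submod. Qed.

(** With [weight_space_disjoint] this gives [M] as the direct sum of the kernel and the image of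
    [T]. The projector is a polynomial in [delta] depending on [x], hence preserves submodules and
    commutes with module maps. *)
Lemma weight_space_split (M : lmodType A) (x : M) : bounded M ->
  exists s, T *: (x - T *: (ev s *: x)) = 0.
Proof.
move=> bM; have [_ _ split _] := weight_poly bM; have [s sE] := split x.
exists s; rewrite scalerBr {1}sE !rmorphM /= !scalerA -!mulrA.
by rewrite subrr.
Qed.

Lemma weight_space_disjoint (M : lmodType A) (x : M) : bounded M ->
  T *: (T *: x) = 0 -> T *: x = 0.
Proof.
move=> bM Tx; have [_ stab _ _] := weight_poly bM; apply: (stab x 2%N).
by rewrite expr2 rmorphM /= -scalerA.
Qed.

(** Faithfulness: for [x] in [Y'] outside [Y], some [a *: x] stays outside [Y] while [T] sends it
    into [Y]; by the splitting it differs by an element of [Y] from a vector of [Y'] in the kernel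
    of [T]. *)
Lemma weight_space_detects (M : lmodType A) (Y Y' : set M) : bounded M ->
  submod_closed [in Y] -> submod_closed [in Y'] ->
  (forall x, Y' x -> T *: x = 0 -> Y x) -> Y' `<=` Y.
Proof.
move=> bM hY hY' sub x Y'x; apply: contrapT => Yx.
have [_ _ _ detect] := weight_poly bM; have [a [Yax YTax]] := detect _ _ hY Yx.
apply: Yax; have [s sE] := weight_space_split (a *: x) bM.
have Yz : Y (T *: (ev s *: (a *: x))).
  by rewrite scalerA ev_comm -scalerA; exact: submodZ.
rewrite -[a *: x](subrK (T *: (ev s *: (a *: x)))); apply: submodD => //.
apply: sub => //; apply: submodB => //; first exact: submodZ.
by rewrite !scalerA; exact: submodZ.
Qed.

Lemma weight_space_finite (M : lmodType A) (Y : set M) : fg_bounded M ->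
  submod_closed [in Y] ->
  exists n (e : 'I_n -> Kmodule M), weight_space (M := M) `&` Y = fam_span e.
Proof.
move=> oM hY; have [n rn] := generalized_kernel_finite oM q_neq0.
have [||m _ [e eE]] := @rank_le_submod K (Kmodule M) (weight_space (M := M) `&` Y) n.
- have hT := weight_space_submod M; have hY' := Kmodule_submod hY.
  apply/submodP; split=> [|c x y [Tx Yx] [Ty Yy]].
    by split; [exact: submod0 hT|exact: submod0 hY'].
  by split; [exact: (submodL hT)|exact: (submodL hY')].
- apply: rank_le_sub rn => x [Tx _]; exists 1%N; by rewrite expr1.
by exists m, e.
Qed.

Fact comb_linear (M : lmodType A) n (e : 'I_n -> M) :
  linear (fun v : {ffun 'I_n -> A^o} => \sum_(j < n) (v j : A) *: e j).
Proof.
move=> a u v; rewrite scaler_sumr -big_split /=; apply: eq_bigr => j _.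
by rewrite !ffunE scalerDl scalerA.
Qed.
Definition comb (M : lmodType A) n (e : 'I_n -> M) :
  {linear {ffun 'I_n -> A^o} -> M} := linear_of (comb_linear e).

Lemma combE (M : lmodType A) n (e : 'I_n -> M) v :
  comb e v = \sum_(j < n) (v j : A) *: e j.
Proof. by []. Qed.

Definition unit_vec n (j : 'I_n) : {ffun 'I_n -> A^o} := [ffun i => (i == j)%:R].

Lemma comb_unit (M : lmodType A) n (e : 'I_n -> M) (j : 'I_n) :
  comb e (unit_vec j) = e j.
Proof.
rewrite combE (bigD1 j) //= ffunE eqxx scale1r big1 ?addr0 // => i ij.
by rewrite ffunE (negPf ij) scale0r.
Qed.

Lemma weight_space_generates (M : lmodType A) (Y : set M) n (e : 'I_n -> Kmodule M) :
  bounded M -> submod_closed [in Y] -> weight_space (M := M) `&` Y = fam_span e ->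
  Y `<=` range (comb (e : 'I_n -> M)).
Proof.
move=> bM hY eE; apply: weight_space_detects => // [|x Yx Tx].
  exact/submod_image/submod_setT.
have : (@weight_space M `&` Y) x by split.
rewrite eE => /fam_spanP[c ->]; exists [ffun j => (c j)%:A] => //.
by rewrite combE; apply: eq_bigr => j _; rewrite ffunE.
Qed.

Lemma generated_by_weight_space (M : lmodType A) (Y : set M) : fg_bounded M ->
  submod_closed [in Y] -> exists n (e : 'I_n -> M),
    (forall j, T *: e j = 0 /\ Y (e j)) /\ Y `<=` range (comb e).
Proof.
move=> oM hY; have [n [e eE]] := weight_space_finite oM hY.
exists n, e; split; last by apply: weight_space_generates => //; case: oM.
by move=> j; have : fam_span e (e j) by [exact: fam_span_gen]; rewrite -eE.
Qed.

Lemma bounded_sub (M N : lmodType A) (f : {linear M -> N}) :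
  injective f -> bounded N -> bounded M.
Proof.
move=> injf bN x; have [n xn] := bN (f x); exists n => m mn a Ga.
by apply: injf; rewrite linearZ linear0; exact: xn Ga.
Qed.

Lemma bounded_quot (M N : lmodType A) (f : {linear M -> N}) :
  (forall y, exists x, f x = y) -> bounded M -> bounded N.
Proof.
move=> surf bM y; have [x <-] := surf y; have [n xn] := bM x.
by exists n => m mn a Ga; rewrite -linearZ (xn _ mn _ Ga) linear0.
Qed.

Lemma finitely_generatedP (M : lmodType A) :
  finitely_generated_module M <->
  exists n (e : 'I_n -> M), forall x, exists v, comb e v = x.
Proof.
split=> -[n [e eP]]; exists n, e => x.
  have [a ->] := eP x; exists [ffun j => a j]; rewrite combE.
  by apply: eq_bigr => j _; rewrite ffunE.
by have [v <-] := eP x; exists v.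
Qed.

Lemma fg_quot (M N : lmodType A) (f : {linear M -> N}) :
  (forall y, exists x, f x = y) ->
  finitely_generated_module M -> finitely_generated_module N.
Proof.
move=> surf [n [e eP]]; exists n, (fun j => f (e j)) => y.
have [x <-] := surf y; have [a ->] := eP x; exists a; rewrite linear_sum.
by apply: eq_bigr => j _; rewrite linearZ.
Qed.

Lemma fg_bounded_quot (M N : lmodType A) (f : {linear M -> N}) :
  (forall y, exists x, f x = y) -> fg_bounded M -> fg_bounded N.
Proof.
by move=> surf [fM bM]; split; [exact: fg_quot fM|exact: bounded_quot bM].
Qed.

(** The part of the weight space lying in [S] is finite dimensional and generates [S], which
    replaces a noetherian argument. *)
Lemma fg_bounded_sub (M : lmodType A) (S : set M) (hS : submod_closed [in S]) :
  fg_bounded M -> fg_bounded (submod_type hS).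
Proof.
move=> oM; split; last first.
  by case: oM => _; apply: bounded_sub; exact: (@submod_val_inj _ _ _ hS).
have [n [e [eP eS]]] := generated_by_weight_space oM hS.
have [e' e'P] := choice (fun j => submod_valK hS (eP j).2).
apply/finitely_generatedP; exists n, e' => x.
have [v _ vE] := eS _ (submod_valP x); exists v.
apply: (@submod_val_inj _ _ _ hS); rewrite -vE !combE linear_sum.
by apply: eq_bigr => j _; rewrite linearZ /= -e'P.
Qed.

Lemma fg_bounded_prod (M N : lmodType A) :
  fg_bounded M -> fg_bounded N -> fg_bounded (M * N)%type.
Proof.
move=> [[m [e eP]] bM] [[n [f fP]] bN]; split.
  exists (m + n)%N, (fun j => match split j with
    | inl i => (e i, 0) | inr i => (0, f i) end) => -[x y].
  have [a ->] := eP x; have [b ->] := fP y.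
  exists (fun j => match split j with inl i => a i | inr i => b i end).
  rewrite big_split_ord /=.
  have el i : split (lshift n i) = inl i by exact: unsplitK (inl i).
  have er i : split (rshift m i) = inr i by exact: unsplitK (inr i).
  under [X in _ = X + _]eq_bigr do rewrite el.
  under [X in _ = _ + X]eq_bigr do rewrite er.
  rewrite [RHS]surjective_pairing; apply/pair_equal_spec; split.
    rewrite /= !(raddf_sum fst) /= [X in _ = _ + X]big1 ?addr0 // => i _.
    by rewrite scaler0.
  rewrite /= !(raddf_sum snd) /= [X in _ = X + _]big1 ?add0r // => i _.
  by rewrite scaler0.
move=> [x y]; have [k xk] := bM x; have [l yl] := bN y.
exists (maxn k l) => i ikl a Ga; apply/pair_equal_spec; split.
  by apply: (xk i) => //; lia.
by apply: (yl i) => //; lia.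
Qed.

Lemma fg_bounded_closed : (exists M, fg_bounded M) -> class_closed fg_bounded.
Proof.
move=> ex; split=> // [M S hS|M S hS|M N]; first exact: fg_bounded_sub.
  by apply: fg_bounded_quot; exact: (@quot_proj_surj _ _ _ hS).
exact: fg_bounded_prod.
Qed.

(** * Composition series *)

Lemma minimal_rank (V : lmodType K) (S : set V) r : rank_le S r ->
  exists d, [/\ rank_le S d, (d <= r)%N & forall d', rank_le S d' -> (d <= d')%N].
Proof.
move=> Sr; have ex : exists d, `[< rank_le S d >] by exists r; apply/asboolP.
case: (ex_minnP ex) => d /asboolP Sd dmin; exists d; split=> //.
  by apply: dmin; apply/asboolP.
by move=> d' Sd'; apply: dmin; apply/asboolP.
Qed.

(** By faithfulness a strict inclusion of submodules lowers the rank of the weight space ([drop]),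
    so induction on the rank bound terminates. *)
Lemma composition_chain_exists (M : lmodType A) r (Y : set M) : fg_bounded M ->
  submod_closed [in Y] -> rank_le (@weight_space M `&` Y) r ->
  exists n c, composition_chain n c /\ c n = Y.
Proof.
move=> oM; case: (oM) => _ bM.
have hTY (Z : set M) : submod_closed [in Z] ->
    submod_closed [in @weight_space M `&` Z].
  move=> hZ; have hT := weight_space_submod M; have hZ' := Kmodule_submod hZ.
  apply/submodP; split=> [|c x y [Tx Zx] [Ty Zy]].
    by split; [exact: submod0 hT|exact: submod0 hZ'].
  by split; [exact: (submodL hT)|exact: (submodL hZ')].
have drop (Z Z' : set M) d : submod_closed [in Z] -> submod_closed [in Z'] ->
    Z `<=` Z' -> Z <> Z' -> rank_le (@weight_space M `&` Z') d ->
    exists2 d', (d' < d)%N & rank_le (@weight_space M `&` Z) d'.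
  move=> hZ hZ' ZZ' neq; apply: rank_le_proper.
  - exact: hTY.
  - exact: hTY.
  - by move=> x [Tx /ZZ'].
  apply: contrapT => no; apply: neq; apply/seteqP; split=> //.
  apply: (weight_space_detects bM hZ hZ') => x Z'x Tx; apply: contrapT => Zx.
  by apply: no; exists x => // -[].
elim/ltn_ind: r Y => r IHr Y hY Yr.
have [Y0|Y0] := pselect (Y = [set 0]).
  exists 0%N, (fun=> [set 0]); split=> //.
  by split=> // [k|k x]; first exact: submod_set0.
(* A maximal submodule [Z] of [Y] is found as a proper one whose exact weight rank [d] is
   largest. *)
pose P d := `[< exists Z : set M, [/\ submod_closed [in Z], Z `<=` Y, Z <> Y,
  rank_le (@weight_space M `&` Z) d &
  forall d', rank_le (@weight_space M `&` Z) d' -> (d <= d')%N] >].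
have sub_rank (Z : set M) : Z `<=` Y -> rank_le (@weight_space M `&` Z) r.
  by move=> ZY; apply: rank_le_sub Yr => x [Tx /ZY].
have P0 : exists d, P d.
  have Y0' : [set 0] `<=` Y by move=> _ ->; exact: submod0.
  have [d [d1 _ d2]] := minimal_rank (sub_rank _ Y0').
  exists d; apply/asboolP; exists [set 0].
    split; [exact: submod_set0|exact: Y0'| |exact: d1|exact: d2].
    by move=> e; apply: Y0; rewrite -e.
have Pub d : P d -> (d <= r)%N.
  by move=> /asboolP[Z [_ ZY _ _ dmin]]; exact/dmin/sub_rank.
case: (ex_maxnP P0 Pub) => d /asboolP[Z [hZ ZY nZY Zd Zmin]] dmax.
have [m mr Zm] := drop _ _ _ hZ hY ZY nZY Yr.
have [n [c [[hc c0 cS cmax] cn]]] := IHr m mr Z hZ Zm.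
exists n.+1, (fun k => if (k <= n)%N then c k else Y); split; last by rewrite ltnn.
split=> [k|//|k|k].
- by case: ifP.
- have [kn|nk] := leqP k.+1 n; first by rewrite (ltnW kn); exact: cS.
  case: ifP => [kn|_ x //]; have /eqP -> : k == n by rewrite eqn_leq kn -ltnS.
  by rewrite cn.
- rewrite ltnS => kn; rewrite kn; have [kn'|nk] := leqP k.+1 n.
    exact: cmax.
  have /eqP -> : k == n by rewrite eqn_leq kn -ltnS.
  rewrite cn; split=> // S hS ZS SY; have [->|nSY] := pselect (S = Y); first by right.
  left; apply: contrapT => nSZ.
  (* A submodule strictly between [Z] and [Y] would have larger exact rank than [Z], against the
     choice of [d]. *)
  have [d' [Sd' _ d'min]] := minimal_rank (sub_rank _ SY).
  have [|d'' d''d' Zd''] := drop _ _ _ hZ hS ZS _ Sd'; first by move=> e; apply: nSZ.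
  have /dmax : P d' by apply/asboolP; exists S.
  have := Zmin _ Zd''; lia.
Qed.

Lemma composition_chain_full (M : lmodType A) : fg_bounded M ->
  exists n c, composition_chain n c /\ c n = [set: M].
Proof.
move=> oM; have [n [e eE]] := weight_space_finite oM (submod_setT M).
apply: composition_chain_exists => //; first exact: submod_setT.
by exists e; rewrite eE.
Qed.

(** * Projective and injective modules *)

(** The bound depends only on [N0] and the degrees occurring in [a], not on the module; this
    uniformity makes [proj_module] bounded. *)
Lemma kill_product (a : A) : exists N : nat, forall m b, m <= - N%:Z -> G m b ->
  forall (M : lmodType A) (x : M), killed N0 x -> (b * a) *: x = 0.
Proof.
have [pi [piG _ pi_sum]] := graded_projection_exists gradedA.
have [s aE] := pi_sum a; exists (N0 + \max_(k <- s) absz k)%N => m b mN Gb M x xN.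
rewrite aE mulr_sumr scaler_suml big_seq big1 // => k ks; apply: (xN (m + k)).
  by have : (absz k <= \max_(k <- s) absz k)%N by [exact: leq_bigmax_seq]; lia.
exact: gradingM.
Qed.

(** Quantifying over all bounded modules imposes exactly the relations common to them, so the
    universal property of the quotient is immediate; its own boundedness is what needs proof. *)
Definition free_rel n : set {ffun 'I_n -> A^o} :=
  [set v | forall (M : lmodType A) (e : 'I_n -> M), bounded M ->
     (forall j, T *: e j = 0) -> comb e v = 0].

Lemma free_rel_submod n : submod_closed [in @free_rel n].
Proof.
apply/submodP; split=> [M e _ _|a u v hu hv M e bM Te]; first by rewrite linear0.
by rewrite linearP hu // hv // scaler0 addr0.
Qed.

(* The quotient of [A^n] representing [M |-> (weight_space M)^n] on bounded
   modules. *)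
Definition proj_module n : lmodType A := quotmod_type (@free_rel_submod n).

Lemma sum_unit_vec n (v : {ffun 'I_n -> A^o}) :
  v = \sum_(j < n) (v j : A) *: unit_vec j.
Proof.
apply/ffunP => i; rewrite sum_ffunE (bigD1 i) //= big1 => [|j ji].
  by rewrite !ffunE eqxx addr0 [RHS]mulr1.
by rewrite !ffunE eq_sym (negPf ji) scaler0.
Qed.

Lemma proj_module_lift n (M : lmodType A) (e : 'I_n -> M) : bounded M ->
  (forall j, T *: e j = 0) -> exists h : {linear proj_module n -> M},
  forall v, h (quot_proj (@free_rel_submod n) v) = comb e v.
Proof.
move=> bM Te; apply: surjective_factor => [|v /quot_proj_eq0]; last exact.
exact: quot_proj_surj.
Qed.

Lemma proj_module_fg_bounded n : fg_bounded (proj_module n).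
Proof.
split.
  apply: (fg_quot (@quot_proj_surj _ _ _ (@free_rel_submod n))).
  by exists n, (@unit_vec n) => v; exists v; exact: sum_unit_vec.
move=> z; have [v <-] := quot_proj_surj z.
have [f fP] := choice (fun j => kill_product (v j)).
exists (\max_j f j)%N => m mN a Ga; rewrite -linearZ.
apply/quot_proj_eq0 => M e bM Te; rewrite combE big1 // => j _.
rewrite ffunE; apply: (fP j m) => //.
  by have : (f j <= \max_j f j)%N by [exact: leq_bigmax_cond]; lia.
by have [kill _ _ _] := weight_poly bM; exact: kill.
Qed.

Lemma proj_module_projective n (X Y : lmodType A) (f : {linear X -> Y})
    (g : {linear proj_module n -> Y}) : bounded X -> bounded Y ->
  (forall y, exists x, f x = y) ->
  exists h : {linear proj_module n -> X}, forall z, f (h z) = g z.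
Proof.
move=> bX bY surf; pose y j := g (quot_proj (@free_rel_submod n) (unit_vec j)).
have Ty j : T *: y j = 0.
  rewrite /y -!linearZ (_ : quot_proj _ _ = 0) ?linear0 //.
  by apply/quot_proj_eq0 => M e bM Te; rewrite linearZ comb_unit [LHS]Te.
have lift j : exists x, f x = y j /\ T *: x = 0.
  have [x xy] := surf (y j); have [s Ts] := weight_space_split x bX.
  (* The correction by [T] lands in the kernel of [T] and does not change the image, because [T]
     kills [y j]. *)
  exists (x - T *: (ev s *: x)); split=> //.
  rewrite linearB !linearZ /= xy ev_scaleC scalerN Ty.
  by rewrite oppr0 scaler0 addr0.
have [x xP] := choice lift.
have [h hE] := proj_module_lift bX (fun j => (xP j).2).
exists h => z; have [v <-] := quot_proj_surj z.
rewrite hE combE {2}(sum_unit_vec v) !linear_sum; apply: eq_bigr => j _.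
by rewrite !linearZ /= (xP j).1.
Qed.

Lemma enough_proj_modules (M : lmodType A) : fg_bounded M ->
  exists n (f : {linear proj_module n -> M}), forall y, exists x, f x = y.
Proof.
move=> oM; have [n [e [eP eT]]] := generated_by_weight_space oM (submod_setT M).
have [h hE] := proj_module_lift (proj2 oM) (fun j => (eP j).1).
exists n, h => y; have [v _ <-] := eT y I.
by exists (quot_proj (@free_rel_submod n) v).
Qed.

Lemma weight_space_nonzero (M : lmodType A) : bounded M -> (exists x : M, x <> 0) ->
  exists2 x : M, T *: x = 0 & x <> 0.
Proof.
move=> bM [x x0]; apply: contrapT => no; apply: x0.
have sub (z : M) : setT z -> T *: z = 0 -> [set 0] z.
  by move=> _ Tz; apply: contrapT => z0; apply: no; exists z.
by have := weight_space_detects bM (submod_set0 M) (submod_setT M) sub; move=> /(_ x I).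
Qed.

Lemma killed_submod (M : lmodType A) :
  submod_closed [in [set x : M | exists N, killed N x]].
Proof.
apply/submodP; split=> [|a x y [N xN] [N' yN]].
  by exists 0%N => m _ b _; rewrite scaler0.
have [pi [piG _ pi_sum]] := graded_projection_exists gradedA.
have [s aE] := pi_sum a.
exists (N' + N + \max_(k <- s) absz k)%N => m mN b Gb.
rewrite scalerDr (yN m) ?addr0 //; last by lia.
rewrite scalerA aE mulr_sumr scaler_suml big_seq big1 // => k ks.
apply: (xN (m + k)); last exact: gradingM.
by have : (absz k <= \max_(k <- s) absz k)%N by [exact: leq_bigmax_seq]; lia.
Qed.

(* The coinduced module [Hom_K(A, K^n)], on which [a] acts by right
   translation. *)
Definition coind n : Type := {linear A -> 'rV[K]_n}.
HB.instance Definition _ n := GRing.Zmodule.copy (coind n) {linear A -> 'rV[K]_n}.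

Fact coind_scale_linear n (a : A) (f : coind n) :
  linear (fun b => (f : {linear A -> 'rV[K]_n}) (b * a)).
Proof. by move=> c x y; rewrite mulrDl -scalerAl linearP. Qed.
Definition coind_scale n (a : A) (f : coind n) : coind n :=
  linear_of (coind_scale_linear a f).
Fact coind_scaleA n a b (f : coind n) :
  coind_scale a (coind_scale b f) = coind_scale (a * b) f.
Proof. by apply: linear_ext => c; rewrite !linear_ofE mulrA. Qed.
Fact coind_scale1 n : left_id 1 (@coind_scale n).
Proof. by move=> f; apply: linear_ext => c; rewrite linear_ofE mulr1. Qed.
Fact coind_scaleDr n : right_distributive (@coind_scale n) +%R.
Proof. by move=> a f g; apply: linear_ext => c. Qed.
Fact coind_scaleDl n (f : coind n) : {morph (@coind_scale n)^~ f : a b / a + b}.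
Proof. by move=> a b; apply: linear_ext => c; rewrite /= mulrDr linearD. Qed.
HB.instance Definition _ n := GRing.Zmodule_isLmodule.Build A (coind n)
  (@coind_scaleA n) (@coind_scale1 n) (@coind_scaleDr n) (@coind_scaleDl n).

Definition coind_eval n (f : coind n) : {linear A -> 'rV[K]_n} := f.

Lemma coind_evalZ n (a b : A) (f : coind n) :
  coind_eval (a *: f) b = coind_eval f (b * a).
Proof. by []. Qed.
Lemma coind_evalD n (f g : coind n) b :
  coind_eval (f + g) b = coind_eval f b + coind_eval g b.
Proof. by []. Qed.
Lemma coind_ext n (f g : coind n) :
  (forall b, coind_eval f b = coind_eval g b) -> f = g.
Proof. by move=> fg; apply: linear_ext. Qed.

(** Vanishing on the right ideal [T A] is stable under right translation; the second clause cuts out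
    the largest bounded submodule. *)
Definition inj_pred n : set (coind n) :=
  [set f | (forall b, coind_eval f (T * b) = 0) /\ exists N, killed N f].

Lemma inj_pred_submod n : submod_closed [in @inj_pred n].
Proof.
have hk := killed_submod (coind n).
apply/submodP; split=> [|a f g [Tf kf] [Tg kg]].
  by split=> //; exact: submod0 hk.
split; last exact: (submodL hk).
by move=> b; rewrite coind_evalD coind_evalZ -mulrA Tf Tg addr0.
Qed.

(* It represents [M |-> Hom_K(M / T M, K^n)], the dual of [weight_space M] to the
   [n]-th power, on bounded modules. *)
Definition inj_module n : lmodType A := submod_type (@inj_pred_submod n).

Definition inj_eval n (f : inj_module n) : {linear A -> 'rV[K]_n} :=
  coind_eval (submod_val (@inj_pred_submod n) f).

Lemma inj_evalZ n a b (f : inj_module n) :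
  inj_eval (a *: f) b = inj_eval f (b * a).
Proof. by []. Qed.
Lemma inj_evalD n (f g : inj_module n) b :
  inj_eval (f + g) b = inj_eval f b + inj_eval g b.
Proof. by []. Qed.
Lemma inj_eval0 n b : inj_eval (0 : inj_module n) b = 0. Proof. by []. Qed.
Lemma inj_ext n (f g : inj_module n) :
  (forall b, inj_eval f b = inj_eval g b) -> f = g.
Proof.
by move=> fg; apply: (@submod_val_inj _ _ _ (@inj_pred_submod n)); exact: coind_ext.
Qed.
Lemma inj_evalT n (f : inj_module n) b : inj_eval f (T * b) = 0.
Proof. by have [Tf _] := submod_valP f; exact: Tf. Qed.

Lemma inj_module_bounded n : bounded (inj_module n).
Proof.
move=> f; have [_ [N fN]] := submod_valP f; exists N => m mN a Ga.
by apply: (@submod_val_inj _ _ _ (@inj_pred_submod n)); exact: fN Ga.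
Qed.

(** Frobenius reciprocity for coinduction: a functional killing [T M] is the same as a module map,
    recovered by evaluation at 1. *)
Lemma inj_module_hom n (M : lmodType A) (phi : {linear Kmodule M -> 'rV[K]_n}) :
  bounded M -> (forall x : M, phi (T *: x) = 0) ->
  exists h : {linear M -> inj_module n}, forall x b, inj_eval (h x) b = phi (b *: x).
Proof.
move=> bM Tphi; pose h0 (x : M) : coind n := lin_comp phi (act x).
have h0L : linear h0.
  move=> a x y; apply: coind_ext => b; rewrite coind_evalD coind_evalZ.
  by rewrite /coind_eval /h0 /= scalerDr -linearD scalerA.
have h0P x : inj_pred (h0 x).
  split=> [b|]; first by rewrite /coind_eval /h0 /= -scalerA.
  have [N xN] := bM x; exists N => m mN a Ga; apply: coind_ext => b.
  rewrite coind_evalZ /coind_eval /h0 /= -scalerA (xN _ mN _ Ga) scaler0.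
  by rewrite linear0.
have [|x|h hE] := injective_factor (f := submod_val (@inj_pred_submod n))
    (g := linear_of h0L); first exact: submod_val_inj.
  exact: submod_valK.
by exists h => x b; rewrite /inj_eval hE.
Qed.

Fact inj_sample_linear n r (s : 'I_r -> A) :
  linear (fun f : Kmodule (inj_module n) =>
    mxvec (\matrix_(i < r, j < n) inj_eval f (s i) 0 j)).
Proof.
move=> c f g.
have E b : inj_eval (c *: f + g : Kmodule (inj_module n)) b =
    c *: inj_eval f b + inj_eval g b.
  transitivity (inj_eval ((c%:A : A) *: (f : inj_module n) + g) b); first by [].
  by rewrite inj_evalD inj_evalZ -scalerAr mulr1 linearZ.
rewrite -linearP; congr mxvec; apply/matrixP => i j.
by rewrite [LHS]mxE (E (s i)) !mxE.
Qed.

(** An [f] in the weight space vanishes on [T A] and on [A T], hence on every [A(m)] with [m] far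
    from 0; on the remaining degrees, being killed up to [-N0], it is determined by its values on
    the finite samples [F m]. *)
Lemma inj_module_fg n : finitely_generated_module (inj_module n).
Proof.
have [N1 N1P] := coprimep_shift q_neq0 q_neq0.
pose S := [seq k%:Z | k <- iota 0 N1] ++ [seq - k%:Z | k <- iota 0 N1].
have [F FP] := choice (component_fin N0).
pose s := flatten [seq F m | m <- S].
have hT := weight_space_submod (inj_module n).
have bI := @inj_module_bounded n.
have sP m b : (absz m < N1)%N -> b \in F m -> exists i : 'I_(size s), s`_i = b.
  move=> mN bF; have bs : b \in s.
    by apply/flattenP; exists (F m) => //; apply: map_f; exact: mem_range_int.
  by move: (bs); rewrite -index_mem => lt; exists (Ordinal lt); exact: nth_index.
have := @rank_le_injective K (Kmodule (inj_module n)) _ _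
  (linear_of (@inj_sample_linear n _ (fun i : 'I_(size s) => s`_i))) hT.
case=> [f Tf|e eS].
  rewrite linear_ofE => /eqP; rewrite mxvec_eq0 => /eqP f0.
  have fs i : inj_eval f s`_(i : 'I_(size s)) = 0.
    by apply/rowP => j; have /matrixP/(_ i j) := f0; rewrite !mxE.
  have fT b : inj_eval f (b * T) = 0.
    by rewrite -inj_evalZ; move: Tf => ->; rewrite inj_eval0.
  have fN0 : killed N0 (f : inj_module n).
    by have [kill _ _ _] := weight_poly bI; exact: kill.
  apply: inj_ext => b; rewrite inj_eval0.
  have [pi [piG _ pi_sum]] := graded_projection_exists gradedA.
  have [sb ->] := pi_sum b; rewrite linear_sum big1 // => m _.
  move: (piG m b); move: (pi m b) => {}b Gb.
  have [mN|mN] := ltnP (absz m) N1.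
    have [c Fc /= bc] := FP m _ (killed_ideal fN0) b Gb.
    have -> : inj_eval f b = inj_eval f c.
      apply/eqP; rewrite -subr_eq0 -linearB -[b - c]mul1r -inj_evalZ bc.
      by rewrite inj_eval0.
    suff : lin_span [set` F m] `<=` [set c | inj_eval f c = 0] by apply.
    apply: lin_span_sub => [|d /= /(sP _ _ mN)[i <-]]; first exact: submod_ker.
    exact: fs.
  have /Bezout_eq1_coprimepP[[u v] /= uv] : coprimep q (shift_poly (- m) q).
    by apply: N1P; rewrite abszN.
  (* Moving [T] leftwards past [b] shifts [q] by [-m], so the Bezout relation writes [b] as an
     element of [T A + A T]. *)
  have -> : b = T * (ev u * b) + ev v * b * T.
    rewrite -[LHS]mul1r -(rmorph1 (horner_alg delta)) -uv rmorphD !rmorphM /=.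
    by rewrite mulrDl -!mulrA (mul_ev innerA _ Gb) mulrA ev_comm -mulrA.
  by rewrite linearD inj_evalT fT addr0.
have TT : weight_space (M := inj_module n) `&` setT = weight_space (M := inj_module n).
  by rewrite setIT.
have [m _ [e' e'E]] := rank_le_submod hT (ex_intro _ e eS).
apply/finitely_generatedP; exists m, e' => x.
have gen := weight_space_generates bI (submod_setT _) (etrans TT e'E).
by have [v _ <-] := gen x I; exists v.
Qed.

Lemma inj_module_injective n (X Y : lmodType A) (f : {linear X -> Y})
    (g : {linear X -> inj_module n}) : fg_bounded Y -> injective f ->
  exists h : {linear Y -> inj_module n}, forall x, h (f x) = g x.
Proof.
move=> oY injf; have [_ bY] := oY.
(* The functional [x |-> g(x)(1)] carried to [f X] and set to 0 on [T Y]; the finite-dimensional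
   weight space covers the rest of [Y]. *)
pose R (y : Kmodule Y) (u : 'rV[K]_n) :=
  exists x z, (y : Y) = f x + T *: z /\ u = inj_eval (g x) 1.
have [m [e eE]] := weight_space_finite oY (submod_setT Y).
have evc (c : K) (x : X) : inj_eval (g (c%:A *: x)) 1 = c *: inj_eval (g x) 1.
  by rewrite linearZ inj_evalZ mul1r linearZ.
have RL : linear_relation R.
  split=> [|c y u y' u' [x [z [-> ->]]] [x' [z' [-> ->]]]].
    exists 0, 0; rewrite linear0 scaler0 addr0; split=> //.
    by rewrite linear0 inj_eval0.
  exists (c%:A *: x + x'), (c%:A *: z + z'); split; last first.
    by rewrite linearD inj_evalD evc.
  rewrite Kmodule_scaleE linearP scalerDr addrACA scalerDr !scalerA.
  by rewrite scalar_comm.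
have [||||||h [_ hR]] := @linear_selection K (Kmodule Y) 'rV[K]_n (fun _ _ => True)
    R m e.
- by split.
- exact: RL.
- by move=> x; exists 0.
- by [].
(* Well-definedness: if [f x] lies in [T Y], the splitting and injectivity of [f] give [x] in [T X],
   where the functional vanishes. *)
- move=> u [x [z [/esym/eqP]]]; rewrite addr_eq0 -scalerN => /eqP fx ->.
  have [_ stab split _] := weight_poly bY; have [t tE] := split (- z).
  have xE : x = T *: (ev t *: x).
    apply: injf; rewrite !linearZ /= fx {1}tE !rmorphM /= -!scalerA.
    by rewrite (ev_scaleC t).
  by rewrite xE linearZ inj_evalZ mul1r -[T]mulr1 inj_evalT.
- move=> y; have [s sE] := weight_space_split y bY.
  exists (T *: (ev s *: y) : Y), (inj_eval (g 0) 1); split.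
    by exists 0, (ev s *: y); rewrite linear0 add0r.
  by rewrite -eE; split.
have [|k kE] := @inj_module_hom n Y h bY.
  move=> y; have -> : 0 = inj_eval (g 0) 1 by rewrite linear0 inj_eval0.
  by apply: hR; exists 0, y; rewrite linear0 add0r.
exists k => x; apply: inj_ext => b; rewrite kE -linearZ.
rewrite (hR _ (inj_eval (g (b *: x)) 1)).
  by rewrite linearZ inj_evalZ mul1r.
by exists (b *: x), 0; rewrite scaler0 addr0.
Qed.

Lemma enough_inj_modules (M : lmodType A) : fg_bounded M ->
  exists n (f : {linear M -> inj_module n}), injective f.
Proof.
move=> oM; have [_ bM] := oM.
have [n [e eE]] := weight_space_finite oM (submod_setT M).
(* [u] gives coordinates in [e] of the projection of [x] to the weight space along [T M]. Since [e]
   is only known to span, a linear choice of [u] needs [linear_selection]. *)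
pose Q (x : Kmodule M) (u : 'rV[K]_n) :=
  exists z : M, (x : M) = lin_comb e u + T *: z.
pose R (x : Kmodule M) (u : 'rV[K]_n) := (exists z : M, x = T *: z) /\ u = 0.
have ZT (c : K) (z : M) : c%:A *: (T *: z) = T *: (c%:A *: z).
  by rewrite !scalerA scalar_comm.
have [||||||h [hQ hR]] := @linear_selection K (Kmodule M) 'rV[K]_n Q R n e.
- split=> [|c x u y v [z ->] [w ->]].
    by exists 0; rewrite linear0 scaler0 addr0.
  exists (c%:A *: z + w); rewrite linearP Kmodule_scaleE scalerDr ZT addrACA.
  by rewrite scalerDr.
- split=> [|c x u y v [[z ->] ->] [[w ->] ->]].
    by split=> //; exists 0; rewrite scaler0.
  split; last by rewrite scaler0 addr0.
  by exists (c%:A *: z + w); rewrite Kmodule_scaleE ZT scalerDr.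
- move=> x; have [s sE] := weight_space_split (x : M) bM.
  have : fam_span e (x - T *: (ev s *: (x : M)) : M) by rewrite -eE.
  move=> [u _ uE]; exists u, (ev s *: (x : M)); apply/eqP.
  by rewrite -subr_eq uE.
- by move=> x u [[z ->] ->]; exists z; rewrite linear0 add0r.
- by move=> u [].
- move=> x; have [s sE] := weight_space_split (x : M) bM.
  exists (T *: (ev s *: (x : M))), 0; split; first by split=> //; exists (ev s *: (x : M)).
  by rewrite -eE.
have [|k kE] := @inj_module_hom n M h bM.
  by move=> x; apply: hR; split=> //; exists x.
exists n, k; have sub x : [set x | k x = 0] x -> T *: x = 0 -> [set 0] x.
  (* Evaluation at 1 gives [h x = 0], so [x] lies in [T M] and in the kernel of [T], which meet in
     0. *)
  move=> /= kx Tx; have hx : h x = 0 by rewrite -[x]scale1r -kE kx inj_eval0.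
  have [z] := hQ x; rewrite hx linear0 add0r => xE.
  by move: Tx; rewrite xE; exact: weight_space_disjoint.
have k0 := weight_space_detects bM (submod_set0 M) (submod_ker k) sub.
move=> x y xy; apply/eqP; rewrite -subr_eq0; apply/eqP/k0.
by rewrite /= linearB xy subrr.
Qed.

Theorem fg_bounded_category : let C := @full_subcategory (module_category A) fg_bounded in
  is_abelian C /\ (forall X : Ob C, has_finite_length X) /\
  finitely_many_simples C /\ enough_projectives C /\ enough_injectives C.
Proof.
move=> C; have hC : class_closed fg_bounded.
  by apply: fg_bounded_closed; exists (proj_module 0); exact: proj_module_fg_bounded.
split; first exact: module_subcategory_abelian.
split.
  move=> [M oM]; have [n [c [cc cn]]] := composition_chain_full oM.
  exact: (chain_finite_length hC oM cc).
split.
  (* One generator suffices: a simple module contains a nonzero vector of the weight space, so it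
     receives a nonzero map from [proj_module 1]. *)
  have oP := proj_module_fg_bounded 1.
  have [n [c [cc cn]]] := composition_chain_full oP.
  apply: (chain_finitely_many_simples hC oP cc cn) => -[M oM].
  move=> /(simple_simple_module hC)[M0 _] /=; case: (oM) => _ bM.
  have [x Tx x0] := weight_space_nonzero bM M0.
  have [h hE] := @proj_module_lift 1 _ (fun=> x) bM (fun=> Tx).
  exists h, (quot_proj (@free_rel_submod 1) (unit_vec ord0)).
  by rewrite hE comb_unit.
split=> -[M oM].
  have [n [f surf]] := enough_proj_modules oM.
  exists (exist _ (proj_module n) (proj_module_fg_bounded n)), f.
  split; last exact/(epi_surjective hC).
  move=> [X oX] [Y oY] p g /(epi_surjective hC) surp.
  have [h hE] := proj_module_projective g (proj2 oX) (proj2 oY) surp.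
  by exists h; apply: linear_ext.
have [n [f injf]] := enough_inj_modules oM.
have oI : fg_bounded (inj_module n).
  by split; [exact: inj_module_fg|exact: inj_module_bounded].
exists (exist _ (inj_module n) oI), f; split; last exact/(mono_injective hC).
move=> [X oX] [Y oY] p g /(mono_injective hC) injp.
have [h hE] := inj_module_injective g oY injp.
by exists h; apply: linear_ext.
Qed.

End BoundedModules.

Theorem theorem2p2p2 (R : realType) (A : algType R[i]) (G : int -> set A)
    (Ap Am : set A) (delta : A)
    (gradedA : algebra_grading G)
    (gradedAp : graded_subalgebra G Ap)
    (gradedAm : graded_subalgebra G Am)
    (T0 : finitely_generated_bimodule Ap Am)
    (T1 : inner_grading G delta)
    (T2 : positivity_conditions G Ap Am) :
  (forall M : lmodType A, in_category_O G Am M ->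
     locally_finite M delta /\
     forall l : R[i], finite_dimensional (generalized_eigenspace M delta l)) /\
  (is_abelian (category_O G Am) /\
   forall X : Ob (category_O G Am), has_finite_length X) /\
  finitely_many_simples (category_O G Am) /\
  (enough_projectives (category_O G Am) /\
   enough_injectives (category_O G Am)).
Proof.
have [[fgp fgm] Apneg Ampos Ap0 Am0] := T2.
have [pi piP] := graded_projection_exists gradedA.
have [||Hp [HpP Hp_span]] :=
    homogeneous_generators gradedA piP (e := 1) gradedAp fgp _ _ Ap0.
- by move=> m; rewrite mul1r; exact: Apneg.
- by move=> m; rewrite mul1r.
have [||Hm [HmP Hm_span]] :=
    homogeneous_generators gradedA piP (e := -1) gradedAm fgm _ _ Am0.
- by move=> m; rewrite mulN1r oppr_lt0; exact: Ampos.
- by move=> m /eqP; rewrite mulN1r oppr_eq0 => /eqP.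
have component_fin (N : nat) (m : int) : exists F : seq A,
    forall L, left_ideal_above G N L -> forall a, G m a ->
    exists2 b, lin_span [set` F] b & L (a - b).
  have [F FP] := component_finite_mod gradedA piP gradedAp gradedAm T0
    HpP HmP Hp_span Hm_span N m.
  by exists F => L [hL LM LN]; exact: FP.
(* Equality of predicates lets the category itself be rewritten; the subalgebras disappear from here
   on. *)
have categoryE : in_category_O G Am = @fg_bounded _ A G.
  apply/funext => M; apply/propext; split=> -[fgM nilM]; split=> // x.
    have [n [_ xn]] := nilM x.
    exact: (nilpotent_bounded gradedA piP gradedAp gradedAm T0 HpP HmP
      Hp_span Hm_span xn).
  have [N xN] := nilM x; exists N.+1; split=> // a aA.
  exact: (bounded_nilpotent gradedA piP xN aA).
have [q [N0 [q0 weight_poly]]] := weight_poly_exists gradedA T1 component_fin.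
have [abel [flen [fsim [eproj einj]]]] :=
  fg_bounded_category gradedA T1 component_fin q0 weight_poly.
rewrite /category_O categoryE; split; last by [].
move=> M oM; split; first exact: (bounded_locally_finite gradedA T1 component_fin (proj2 oM)).
by move=> l; exact: (generalized_eigenspace_finite gradedA T1 component_fin _ oM).
Qed.
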